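(* Let $\{\alpha_k\}_{k\in\mathbb{Z}}$ be complex numbers with $|\alpha_k|<1$ for all $k$. Let $t\in[0,2\pi)$, $k_0\in\mathbb{Z}$, and $z\in\mathbb{C}\setminus\{0\}$ with $|z|\neq1$. Let $\epsilon\in\{0,1\}$ be the residue of $k_0$ modulo $2$ and $\epsilon'=1-\epsilon$ that of $k_0+1$. In terms of matrix entries in the standard basis, the resolvents of the half-lattice CMV operators $U^{(t)}_{\pm,k_0}$ are given as follows. For $k,k'\in[k_0,\infty)\cap\mathbb{Z}$, $$\big(U^{(t)}_{+,k_0}-zI\big)^{-1}(k,k')=\frac{z^{-\epsilon}}{2z}\begin{cases}p^{(t)}_+(z,k,k_0)\,\widehat v^{(t)}_+(z,k',k_0),& k<k'\text{ or }k=k'\text{ odd},\\ \widehat u^{(t)}_+(z,k,k_0)\,r^{(t)}_+(z,k',k_0),&k>k'\text{ or }k=k'\text{ even}\end{cases}$$ $$=\frac1{2z}\begin{cases}-p^{(t)}_+(z,k,k_0)\,\overline{\widehat u^{(t)}_+(1/\overline z,k',k_0)},& k<k'\text{ or }k=k'\text{ odd},\\ \widehat u^{(t)}_+(z,k,k_0)\,\overline{p^{(t)}_+(1/\overline z,k',k_0)},&k>k'\text{ or }k=k'\text{ even};\end{cases}$$ for $k,k'\in(-\infty,k_0]\cap\mathbb{Z}$, $$\big(U^{(t)}_{-,k_0}-zI\big)^{-1}(k,k')=\frac{z^{-\epsilon'}}{2z}\begin{cases}\widehat u^{(t)}_-(z,k,k_0)\,r^{(t)}_-(z,k',k_0),&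 k<k'\text{ or }k=k'\text{ odd},\\ p^{(t)}_-(z,k,k_0)\,\widehat v^{(t)}_-(z,k',k_0),&k>k'\text{ or }k=k'\text{ even}\end{cases}$$ $$=\frac1{2z}\begin{cases}-\widehat u^{(t)}_-(z,k,k_0)\,\overline{p^{(t)}_-(1/\overline z,k',k_0)},& k<k'\text{ or }k=k'\text{ odd},\\ p^{(t)}_-(z,k,k_0)\,\overline{\widehat u^{(t)}_-(1/\overline z,k',k_0)},&k>k'\text{ or }k=k'\text{ even};\end{cases}$$ where the sequences $\widehat u^{(t)}_\pm,\widehat v^{(t)}_\pm$ are defined by $$\binom{\widehat u^{(t)}_\pm(z,\cdot,k_0)}{\widehat v^{(t)}_\pm(z,\cdot,k_0)}=\binom{q^{(t)}_\pm(z,\cdot,k_0)}{s^{(t)}_\pm(z,\cdot,k_0)}+m^{(t)}_\pm(z,k_0)\binom{p^{(t)}_\pm(z,\cdot,k_0)}{r^{(t)}_\pm(z,\cdot,k_0)}\in\ell^2([k_0,\pm\infty)\cap\mathbb{Z})^2 .$$ For the full-lattice CMV operator $U$ and $k,k'\in\mathbb{Z}$, $$(U-zI)^{-1}(k,k')=\frac{-z^{-\epsilon}}{2z\,[M^{(t)}_+(z,k_0)-M^{(t)}_-(z,k_0)]}\begin{cases}u^{(t)}_-(z,k,k_0)\,v^{(t)}_+(z,k',k_0),& k<k'\text{ or }k=k'\text{ odd},\\ u^{(t)}_+(z,k,k_0)\,v^{(t)}_-(z,k',k_0),&k>k'\text{ or }k=k'\text{ even}\end{cases}$$ $$=\frac{1}{2z\,[M^{(t)}_+(z,k_0)-M^{(t)}_-(z,k_0)]}\begin{cases}u^{(t)}_-(z,k,k_0)\,\overline{u^{(t)}_+(1/\overline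 z,k',k_0)},& k<k'\text{ or }k=k'\text{ odd},\\ u^{(t)}_+(z,k,k_0)\,\overline{u^{(t)}_-(1/\overline z,k',k_0)},&k>k'\text{ or }k=k'\text{ even}.\end{cases}$$ Moreover, since $U^{(t)}_{\pm,k_0}$ and $U$ are unitary, so that zero is in their resolvent sets, all these formulas extend analytically to $z=0$.
   Context: Set $\rho_k=(1-|\alpha_k|^2)^{1/2}$ and $\Theta_k=\begin{pmatrix}-\alpha_k&\rho_k\\ \rho_k&\overline{\alpha_k}\end{pmatrix}$. Let $V$ and $W$ be the block-diagonal unitary operators on $\ell^2(\mathbb{Z})$ such that for each even $k$, $V$ has the block $\Theta_k$ in rows and columns $(k-1,k)$; for each odd $k$, $W$ has the block $\Theta_k$ in rows and columns $(k-1,k)$; all other entries vanish. The full-lattice CMV operator is $U=VW$. Replacing $\alpha_{k_1}$ by $e^{it}$ (so $\Theta_{k_1}$ becomes $\mathrm{diag}(-e^{it},e^{-it})$) and keeping the other $\alpha_k$, the resulting CMV operator splits as $U^{(t)}_{-,k_1-1}\oplus U^{(t)}_{+,k_1}$ on $\ell^2((-\infty,k_1-1]\cap\mathbb{Z})\oplus\ell^2([k_1,\infty)\cap\mathbb{Z})$. Thus $U^{(t)}_{+,k_0}$ is obtained by setting $\alpha_{k_0}=e^{it}$ and $U^{(t)}_{-,k_0}$ by setting $\alpha_{k_0+1}=e^{it}$. For an operator $A$, $A(k,k')=(\delta_k,A\delta_{k'})$. Transfer matrices ($z\ne0$): $T(z,k)=\frac1{\rho_k}\begin{pmatrix}\alpha_k&z\\1/z&\overline{\alpha_k}\end{pmatrix}$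 for $k$ odd, $T(z,k)=\frac1{\rho_k}\begin{pmatrix}\overline{\alpha_k}&1\\1&\alpha_k\end{pmatrix}$ for $k$ even. With $\gamma=e^{-it/2}$, the sequences $\binom{p^{(t)}_\pm(z,k,k_0)}{r^{(t)}_\pm(z,k,k_0)}$ and $\binom{q^{(t)}_\pm(z,k,k_0)}{s^{(t)}_\pm(z,k,k_0)}$, $k\in\mathbb{Z}$, are the solutions of $\binom{u(k)}{v(k)}=T(z,k)\binom{u(k-1)}{v(k-1)}$, $k\in\mathbb{Z}$, with initial values at $k=k_0$: $\binom{p_+}{r_+}=\binom{z\overline\gamma}{\gamma}$, $\binom{q_+}{s_+}=\binom{z\overline\gamma}{-\gamma}$, $\binom{p_-}{r_-}=\binom{\overline\gamma}{-\gamma}$, $\binom{q_-}{s_-}=\binom{\overline\gamma}{\gamma}$ if $k_0$ is odd; $\binom{p_+}{r_+}=\binom{\gamma}{\overline\gamma}$, $\binom{q_+}{s_+}=\binom{-\gamma}{\overline\gamma}$, $\binom{p_-}{r_-}=\binom{-z\gamma}{\overline\gamma}$, $\binom{q_-}{s_-}=\binom{z\gamma}{\overline\gamma}$ if $k_0$ is even. The half-lattice Weyl–Titchmarsh functions are $m^{(t)}_\pm(z,k_0)=\pm\big(\delta_{k_0},(U^{(t)}_{\pm,k_0}+zI)(U^{(t)}_{\pm,k_0}-zI)^{-1}\delta_{k_0}\big)$, $|z|\ne1$. The functions $M^{(t)}_\pm(z,k_0)$ are the unique complex numbers such that $$\binom{u^{(t)}_\pm(z,\cdot,k_0)}{v^{(t)}_\pm(z,\cdot,k_0)}=\binom{q^{(t)}_+(z,\cdot,k_0)}{s^{(t)}_+(z,\cdot,k_0)}+M^{(t)}_\pm(z,k_0)\binom{p^{(t)}_+(z,\cdot,k_0)}{r^{(t)}_+(z,\cdot,k_0)}\in\ell^2([k_0,\pm\infty)\cap\mathbb{Z})^2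 ,$$ which also defines $u^{(t)}_\pm,v^{(t)}_\pm$. Here $[k_0,-\infty)$ means $(-\infty,k_0]$. *)

(* Defs.v *)
From HB Require Import structures.
From mathcomp Require Import all_boot all_order all_algebra.
From mathcomp Require Import complex.
From mathcomp Require Import all_classical all_reals all_analysis.

Set Implicit Arguments.
Unset Strict Implicit.
Unset Printing Implicit Defensive.

Import Order.TTheory GRing.Theory Num.Theory.
Import numFieldNormedType.Exports.

Local Open Scope classical_set_scope.
Local Open Scope ring_scope.

Section l2.
Variable R : realType.
Local Notation C := R[i].
Implicit Types (D : set int) (f g : int -> C) (A G : (int -> C) -> (int -> C)).

(* squared norm of the restriction of f to D *)
Definition l2norm2 D f : \bar R :=
  \esum_(k in D) ((Normc.normc (f k)) ^+ 2)%:E.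

(* the restriction of f to D is square-summable; no condition off D *)
Definition l2on D f : Prop := (l2norm2 D f < +oo)%E.

(* l^2(D), realized as the square-summable sequences on Z that vanish off D *)
Definition l2 D : set (int -> C) :=
  [set f | (forall k, ~ D k -> f k = 0) /\ l2on D f].

(* limit of symmetric partial sums; the series converges absolutely on l^2 *)
Definition l2dot f g : C :=
  lim ((fun n : nat =>
          (\sum_(i < n.*2.+1) (f (i%:Z - n%:Z))^* * g (i%:Z - n%:Z)) : C^o)
       @ \oo).

Definition delta (k : int) : int -> C := fun j => (j == k)%:R.

Definition entry A (k k' : int) : C := l2dot (delta k) (A (delta k')).

Definition unitary_on D A : Prop :=
  [/\ forall f, l2 D f -> l2 D (A f),
      forall f g, l2 D f -> l2 D g -> l2dot (A f) (A g) = l2dot f g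
    & forall g, l2 D g -> exists2 f, l2 D f & A f = g].

(* the operator A + c I *)
Definition addcI A (c : C) : (int -> C) -> (int -> C) :=
  fun f k => A f k + c * f k.

(* G is a bounded two-sided inverse of A - z I on l^2(D) *)
Definition is_resolvent D A (z : C) G : Prop :=
  [/\ forall f, l2 D f -> l2 D (G f) /\ addcI A (- z) (G f) = f,
      forall f, l2 D f -> l2 D (addcI A (- z) f) /\ G (addcI A (- z) f) = f
    & exists c : R, forall f, l2 D f ->
        (l2norm2 D (G f) <= c%:E * l2norm2 D f)%E].

Definition in_resolvent_set D A (z : C) : Prop :=
  exists G, is_resolvent D A z G.

(* (A - z I)^{-1}; unspecified off l^2(D), or if z is in the spectrum *)
Definition resolvent D A (z : C) : (int -> C) -> (int -> C) :=
  xget (fun f => f)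
    [set G : (int -> C) -> (int -> C) | is_resolvent D A z G].

End l2.

Arguments delta {R}.

Section CMV.
Variable R : realType.
Local Notation C := R[i].
Implicit Types (alpha : int -> C) (t : R) (z : C) (k : int).

Definition oddz k : bool := odd `|k|%N.

Definition expi t : C := Complex (cos t) (sin t).

Definition mx2 (a b c d : C) : 'M[C]_2 :=
  \matrix_(i, j) if i == 0 then (if j == 0 then a else b)
                 else (if j == 0 then c else d).

Definition cv2 (a b : C) : 'cV[C]_2 := \col_i if i == 0 then a else b.

Definition rho (a : C) : C := sqrtC (1 - `|a| ^+ 2).

Definition Theta (a : C) : 'M[C]_2 := mx2 (- a) (rho a) (rho a) a^*.

(* The block-diagonal operator with block Theta (alpha k) in rows and columns
   (k-1, k) for each k with [oddz k = b]: row k lies in the block of index k or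
   of index k+1, depending on its parity. *)
Definition block_op (b : bool) alpha (f : int -> C) : int -> C := fun k =>
  if oddz k == b then
    Theta (alpha k) 1 0 * f (k - 1) + Theta (alpha k) 1 1 * f k
  else
    Theta (alpha (k + 1)) 0 0 * f k + Theta (alpha (k + 1)) 0 1 * f (k + 1).

Definition Vop alpha := block_op false alpha.
Definition Wop alpha := block_op true alpha.

Definition CMV alpha (f : int -> C) : int -> C := Vop alpha (Wop alpha f).

Definition set_alpha alpha t k1 : int -> C :=
  fun k => if k == k1 then expi t else alpha k.

Definition Zge k0 : set int := [set k | k0 <= k].
Definition Zle k0 : set int := [set k | k <= k0].

(* The half-lattice operators are the restrictions of these two to
   [l2 (Zge k0)] and [l2 (Zle k0)] respectively, which they leave invariant. *)
Definition CMV_plus alpha t k0 := CMV (set_alpha alpha t k0).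
Definition CMV_minus alpha t k0 := CMV (set_alpha alpha t (k0 + 1)).

Definition transfer alpha z k : 'M[C]_2 :=
  (rho (alpha k))^-1 *:
    (if oddz k then mx2 (alpha k) z z^-1 (alpha k)^*
     else mx2 (alpha k)^* 1 1 (alpha k)).

(* the solution on Z of the transfer recursion with value c at k0 *)
Definition transfer_sol alpha z k0 (c : 'cV[C]_2) : int -> 'cV[C]_2 :=
  xget (fun=> 0)
    [set w | (forall k, w k = transfer alpha z k *m w (k - 1)) /\ w k0 = c].

Definition gam t : C := expi (- (t / 2)).

Definition pr_plus alpha t k0 z := transfer_sol alpha z k0
  (if oddz k0 then cv2 (z * (gam t)^*) (gam t) else cv2 (gam t) (gam t)^*).
Definition qs_plus alpha t k0 z := transfer_sol alpha z k0
  (if oddz k0 then cv2 (z * (gam t)^*) (- gam t) else cv2 (- gam t) (gam t)^*).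
Definition pr_minus alpha t k0 z := transfer_sol alpha z k0
  (if oddz k0 then cv2 (gam t)^* (- gam t) else cv2 (- (z * gam t)) (gam t)^*).
Definition qs_minus alpha t k0 z := transfer_sol alpha z k0
  (if oddz k0 then cv2 (gam t)^* (gam t) else cv2 (z * gam t) (gam t)^*).

Definition p_plus alpha t k0 z k : C := pr_plus alpha t k0 z k 0 0.
Definition r_plus alpha t k0 z k : C := pr_plus alpha t k0 z k 1 0.
Definition p_minus alpha t k0 z k : C := pr_minus alpha t k0 z k 0 0.
Definition r_minus alpha t k0 z k : C := pr_minus alpha t k0 z k 1 0.

Definition m_plus alpha t k0 z : C :=
  let U := CMV_plus alpha t k0 in
  l2dot (delta k0) (addcI U z (resolvent (Zge k0) U z (delta k0))).
Definition m_minus alpha t k0 z : C :=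
  let U := CMV_minus alpha t k0 in
  - l2dot (delta k0) (addcI U z (resolvent (Zle k0) U z (delta k0))).

Definition uvhat_plus alpha t k0 z k : 'cV[C]_2 :=
  qs_plus alpha t k0 z k + m_plus alpha t k0 z *: pr_plus alpha t k0 z k.
Definition uvhat_minus alpha t k0 z k : 'cV[C]_2 :=
  qs_minus alpha t k0 z k + m_minus alpha t k0 z *: pr_minus alpha t k0 z k.

Definition uhat_plus alpha t k0 z k : C := uvhat_plus alpha t k0 z k 0 0.
Definition vhat_plus alpha t k0 z k : C := uvhat_plus alpha t k0 z k 1 0.
Definition uhat_minus alpha t k0 z k : C := uvhat_minus alpha t k0 z k 0 0.
Definition vhat_minus alpha t k0 z k : C := uvhat_minus alpha t k0 z k 1 0.

Definition l2vec (D : set int) (w : int -> 'cV[C]_2) : Prop :=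
  l2on D (fun k => w k 0 0) /\ l2on D (fun k => w k 1 0).

Definition weyl_comb alpha t k0 z (M : C) k : 'cV[C]_2 :=
  qs_plus alpha t k0 z k + M *: pr_plus alpha t k0 z k.

Definition M_plus alpha t k0 z : C := xget 0
  [set M | unique (fun M => l2vec (Zge k0) (weyl_comb alpha t k0 z M)) M].
Definition M_minus alpha t k0 z : C := xget 0
  [set M | unique (fun M => l2vec (Zle k0) (weyl_comb alpha t k0 z M)) M].

Definition uv_plus alpha t k0 z := weyl_comb alpha t k0 z (M_plus alpha t k0 z).
Definition uv_minus alpha t k0 z :=
  weyl_comb alpha t k0 z (M_minus alpha t k0 z).

Definition u_plus alpha t k0 z k : C := uv_plus alpha t k0 z k 0 0.
Definition v_plus alpha t k0 z k : C := uv_plus alpha t k0 z k 1 0.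
Definition u_minus alpha t k0 z k : C := uv_minus alpha t k0 z k 0 0.
Definition v_minus alpha t k0 z k : C := uv_minus alpha t k0 z k 1 0.

(* k < k', or k = k' odd; the negation is k > k', or k = k' even *)
Definition upper k k' : bool := (k < k') || ((k == k') && oddz k).

(* Each resolvent has two closed forms, [_uv] using second components at z and
   [_uu] using first components at 1 / z^*. *)
Definition G_plus_uv alpha t k0 k k' z : C :=
  z ^- oddz k0 / (2 * z) *
  (if upper k k' then p_plus alpha t k0 z k * vhat_plus alpha t k0 z k'
   else uhat_plus alpha t k0 z k * r_plus alpha t k0 z k').

Definition G_plus_uu alpha t k0 k k' z : C :=
  1 / (2 * z) *
  (if upper k k' then
     - p_plus alpha t k0 z k * (uhat_plus alpha t k0 (1 / z^*) k')^*
   else uhat_plus alpha t k0 z k * (p_plus alpha t k0 (1 / z^*) k')^*).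

Definition G_minus_uv alpha t k0 k k' z : C :=
  z ^- oddz (k0 + 1) / (2 * z) *
  (if upper k k' then uhat_minus alpha t k0 z k * r_minus alpha t k0 z k'
   else p_minus alpha t k0 z k * vhat_minus alpha t k0 z k').

Definition G_minus_uu alpha t k0 k k' z : C :=
  1 / (2 * z) *
  (if upper k k' then
     - uhat_minus alpha t k0 z k * (p_minus alpha t k0 (1 / z^*) k')^*
   else p_minus alpha t k0 z k * (uhat_minus alpha t k0 (1 / z^*) k')^*).

Definition G_full_uv alpha t k0 k k' z : C :=
  - z ^- oddz k0 / (2 * z * (M_plus alpha t k0 z - M_minus alpha t k0 z)) *
  (if upper k k' then u_minus alpha t k0 z k * v_plus alpha t k0 z k'
   else u_plus alpha t k0 z k * v_minus alpha t k0 z k').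

Definition G_full_uu alpha t k0 k k' z : C :=
  1 / (2 * z * (M_plus alpha t k0 z - M_minus alpha t k0 z)) *
  (if upper k k' then
     u_minus alpha t k0 z k * (u_plus alpha t k0 (1 / z^*) k')^*
   else u_plus alpha t k0 z k * (u_minus alpha t k0 (1 / z^*) k')^*).

(* g is the sum of a power series that converges on the open unit disk *)
Definition analytic_on_disk (g : C -> C) : Prop :=
  exists a : nat -> C, forall z, `|z| < 1 ->
    ([series a n * z ^+ n]_n : C^o ^nat) @ \oo --> (g z : C^o).

(* F, given on the punctured unit disk, extends analytically to 0, where the
   extension takes the value w *)
Definition extends_to_0 (F : C -> C) (w : C) : Prop :=
  exists g : C -> C, [/\ analytic_on_disk g,
    forall z, 0 < `|z| < 1 -> g z = F z & g 0 = w].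

End CMV.

(* Main.v *)
Require Import Defs.
From mathcomp Require Import all_boot all_order all_algebra.
From mathcomp Require Import complex.
From mathcomp Require Import all_classical all_reals all_analysis.
From mathcomp Require Import ring lra zify.

Set Implicit Arguments.
Unset Strict Implicit.
Unset Printing Implicit Defensive.

Import Order.TTheory GRing.Theory Num.Theory.
Import numFieldNormedType.Exports.

Local Open Scope classical_set_scope.
Local Open Scope ring_scope.

(** Why the theorem is true.

    Put [v := z^-1 W u]. Then [U u = z u] says [W u = z v] and [V v = u],
    which splits into one equation for each 2x2 block, and the equation of the
    block [k] is the transfer recursion at [k] ([transfer_step_block_eqs]).
    Hence resolvents are Green functions: if [(u1, v1)] solves the equations of
    the blocks up to [k'] and [(u2, v2)] those of the blocks beyond [k'], the
    kernel [u1 k * v2 k'] above the diagonal, [u2 k * v1 k'] below it, is mapped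
    by [U - z] to a multiple of [delta k'] ([CMV_green]). The multiple is the
    Wronskian of the two solutions; up to the sign [(-1)^k'] it does not depend
    on [k'], because transfer matrices have determinant -1 ([wronskian]). In the
    full-lattice case the two solutions are those which decay at either end. In
    a half-lattice case one of them is [p], truncated: a unimodular coefficient
    makes its block diagonal, and the initial values of [p] express the
    remaining boundary condition ([p_bc], [pm_bc]).

    Existence of the resolvents: a CMV operator is unitary, since its blocks
    are, and its inverse is built from blocks of the same kind. A Neumann
    series, in the inverse if [|z| < 1] and in the operator if [|z| > 1],
    converges entrywise and inverts [U - z] boundedly ([in_resolvent]). For
    [|z| < 1] it is a power series in [z], which is the analytic extension to 0
    ([resolvent_analytic]).

    Decaying solutions: after cutting the lattice at one block, the resolvent
    of the cut operator applied to a vector at the cut is a nonzero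
    square-summable solution on either side ([decaying_solutions]). The solution
    [p] decays at neither end: with its boundary condition it would be an
    eigenvector of a unitary half-lattice operator for an eigenvalue off the
    unit circle. Unitarity of the block at the boundary turns the condition on
    one half-lattice into one, with another unimodular coefficient, on the
    complementary half-lattice, so that this covers both ends
    ([unimodular_not_l2]). Existence and uniqueness of [M_plus], [M_minus] and
    of the analogous coefficient for [p_minus], [q_minus] follow
    ([weyl_unique]); the coefficients are distinct, as a solution that decays at
    both ends would be an eigenvector of [U]. Reading off the diagonal entry of
    the Green function at [k0] identifies the coefficients of the half-lattice
    problems with [m_plus] and [m_minus] ([m_plusE], [m_minus_uniq]).

    The second form of each resolvent: if [(u, v)] is a solution at
    [1 / conj z], then [(conj v, conj u)] is a solution at [z]
    ([star_solution]). This map preserves decay and sends [p] and [q] at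
    [1 / conj z] to multiples of [p] and [q] at [z] by the same power of [z], with
    opposite signs. By uniqueness of the coefficients it therefore sends the
    decaying solutions at [1 / conj z] to multiples of those at [z]. *)

(** * Sums over symmetric integer intervals *)

Section Symsum.

Definition symsum (T : zmodType) (a : int -> T) (n : nat) : T :=
  \sum_(i < n.*2.+1) a (i%:Z - n%:Z).

Lemma symsumS (T : zmodType) (a : int -> T) n :
  symsum a n.+1 = symsum a n + (a n.+1%:Z + a (- n.+1%:Z)).
Proof.
rewrite /symsum doubleS big_ord_recr big_ord_recl /=.
have -> : (n.*2.+2%:Z - n.+1%:Z) = n.+1%:Z by lia.
rewrite sub0r addrC addrA [LHS]addrC; congr (_ + _).
  by apply: eq_bigr => i _; congr a; rewrite /bump /=; lia.
Qed.

Lemma symsum0 (T : zmodType) (a : int -> T) : symsum a 0 = a 0.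
Proof. by rewrite /symsum big_ord1. Qed.

Lemma symsum_telescope (T : zmodType) (F : int -> T) n :
  symsum (fun k => F k - F (k - 1)) n = F n%:Z - F (- n%:Z - 1).
Proof.
elim: n => [|n IH]; first by rewrite symsum0 oppr0.
rewrite symsumS IH (_ : n.+1%:Z - 1 = n%:Z); last by lia.
rewrite (_ : - n%:Z - 1 = - n.+1%:Z); last by lia.
set a := F _; set b := F (- _); set c := F n.+1; set d := F _.
rewrite [c - a + _]addrC !addrA [_ + c]addrC -!addrA; congr (c + _).
rewrite [- b + _]addrA [- b + b]addNr add0r.
by rewrite [- d - a]addrC addrA subrr add0r.
Qed.

Lemma symsumD (T : zmodType) (a b : int -> T) n :
  symsum (fun k => a k + b k) n = symsum a n + symsum b n.
Proof. by rewrite /symsum big_split. Qed.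

Lemma eq_symsum (T : zmodType) (a b : int -> T) : a =1 b -> symsum a =1 symsum b.
Proof. by move=> ab n; apply: eq_bigr => i _; rewrite ab. Qed.

Lemma le_symsum (T : numDomainType) (a b : int -> T) n :
  (forall k, a k <= b k) -> symsum a n <= symsum b n.
Proof. by move=> ab; apply: ler_sum. Qed.

Lemma symsum_ge0 (T : numDomainType) (a : int -> T) n :
  (forall k, 0 <= a k) -> 0 <= symsum a n.
Proof. by move=> a0; apply: sumr_ge0. Qed.

Lemma symsumZ (T : pzRingType) (a : int -> T) c n :
  symsum (fun k => c * a k) n = c * symsum a n.
Proof. by rewrite /symsum mulr_sumr. Qed.

Lemma le_symsum_term (T : numDomainType) (a : int -> T) k :
  (forall k, 0 <= a k) -> a k <= symsum a `|k|%N.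
Proof.
move=> a0; case: (intP k) => [|n|n]; first by rewrite symsum0.
- by rewrite symsumS addrCA lerDl addr_ge0// symsum_ge0.
- by rewrite abszN symsumS addrA lerDr addr_ge0// symsum_ge0.
Qed.

Lemma symsum_fset (T : numDomainType) (a : int -> T) (s : seq int) :
  (forall k, 0 <= a k) -> uniq s -> exists n, \sum_(i <- s) a i <= symsum a n.
Proof.
move=> a0 us.
(* the smallest symmetric interval that contains s *)
pose n := (\max_(i <- s) `|i|)%N; exists n.
rewrite /symsum -(big_map (fun i : 'I_ _ => i%:Z - n%:Z) xpredT a).
set t := map _ _.
have ut : uniq t.
  rewrite map_inj_uniq ?index_enum_uniq// => i j /addIr [] ij.
  exact: val_inj.
rewrite [leRHS](bigID [in s]) /= [leLHS](_ : _ = \sum_(i <- t | i \in s) a i).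
  by rewrite lerDl sumr_ge0.
rewrite -[RHS]big_filter; apply: perm_big; apply: uniq_perm => //.
  exact: filter_uniq.
move=> k; rewrite mem_filter; case ks: (k \in s) => //=.
have kn : (`|k| <= n)%N by rewrite /n (big_rem k) //= leq_max leqnn.
symmetry; apply/mapP.
have h : (absz (k + n%:Z)%R < n.*2.+1)%N by lia.
exists (Ordinal h); first by rewrite mem_index_enum.
by rewrite /=; lia.
Qed.

End Symsum.

(** * Square-summable sequences *)

Section L2.
Variable R : realType.
Local Notation C := R[i].
Implicit Types (f g : int -> C) (x y : C).

Definition nsq x : R := Normc.normc x ^+ 2.

Lemma normc_norm x : (Normc.normc x)%:C%C = `|x|.
Proof. by []. Qed.

Lemma nsqE x : (nsq x)%:C%C = x * x^*.
Proof. by rewrite /nsq rmorphXn /= normc_norm normCK. Qed.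

Lemma nsq_ge0 x : 0 <= nsq x.
Proof. exact: sqr_ge0. Qed.

Lemma nsqM x y : nsq (x * y) = nsq x * nsq y.
Proof. by rewrite /nsq Normc.normcM exprMn. Qed.

Lemma nsq0 : nsq 0 = 0.
Proof. by rewrite /nsq Normc.normc0 expr0n. Qed.

Lemma nsq_eq0 x : nsq x = 0 -> x = 0.
Proof. by move/eqP; rewrite sqrf_eq0 => /eqP /Normc.eq0_normc. Qed.

Lemma nsq_conj x : nsq x^* = nsq x.
Proof. by apply: complexI; rewrite !nsqE conjCK mulrC. Qed.

Lemma nsqN x : nsq (- x) = nsq x.
Proof. by apply: complexI; rewrite !nsqE rmorphN mulrNN. Qed.

Lemma nsq_ReIm x : nsq x = complex.Re x ^+ 2 + complex.Im x ^+ 2.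
Proof.
case: x => a b; rewrite /nsq /= sqr_sqrtr //.
by rewrite addr_ge0 ?sqr_ge0.
Qed.

Lemma normc_ge0 x : 0 <= Normc.normc x.
Proof. by case: x => a b; exact: sqrtr_ge0. Qed.

(** Writing the bound on the norm of [x + w * y] as a convex combination, with
    weights [1 - |w|] and [|w|], of [|x| / (1 - |w|)] and [|y|] avoids the
    triangle inequality in l^2: this form can be summed over the lattice, and
    [(1 - |w|) ^- 2] is the fixed point of the resulting recursion on the
    partial sums of a Neumann series. *)
Lemma nsq_convex (w x y : C) : Normc.normc w < 1 ->
  nsq (x + w * y) <= nsq x / (1 - Normc.normc w) + Normc.normc w * nsq y.
Proof.
rewrite /nsq; set r := Normc.normc w => r1.
have r0 : 0 <= r := normc_ge0 w.
have h : Normc.normc (x + w * y) <= Normc.normc x + r * Normc.normc y.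
  by rewrite (le_trans (le_normcD _ _))// Normc.normcM.
have := normc_ge0 x; have := normc_ge0 y.
move: (Normc.normc x) (Normc.normc y) h => a b h b0 a0.
apply: (@le_trans _ _ ((a + r * b) ^+ 2)).
  by rewrite lerXn2r ?nnegrE ?normc_ge0// addr_ge0 ?mulr_ge0.
have r1' : 0 < 1 - r by rewrite subr_gt0.
rewrite -(ler_pM2r r1') [leRHS]mulrDl divfK ?gt_eqF//.
rewrite -subr_ge0 [X in 0 <= X](_ : _ = r * (a - (1 - r) * b) ^+ 2).
  by rewrite mulr_ge0 ?sqr_ge0.
by ring.
Qed.

Lemma nsq_add x y : nsq (x + y) <= 2 * (nsq x + nsq y).
Proof.
rewrite !nsq_ReIm; case: x => a b; case: y => c d /=.
rewrite -subr_ge0 [X in 0 <= X](_ : _ = (a - c) ^+ 2 + (b - d) ^+ 2).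
  by rewrite addr_ge0 ?sqr_ge0.
by ring.
Qed.

(** The squared l^2 norm is used through its upper bounds only, so that no
    limit has to be named; [l2norm2_le] is the link with the sum over all
    finite sets. *)
Definition norm2_le f (c : R) := forall n, symsum (nsq \o f) n <= c.

Definition square_summable f := exists c, norm2_le f c.

Lemma nsq_f_ge0 f k : 0 <= (nsq \o f) k.
Proof. exact: nsq_ge0. Qed.

Lemma norm2_le_term f c k : norm2_le f c -> nsq (f k) <= c.
Proof. by move=> /(_ `|k|%N); apply/le_trans/(le_symsum_term k (@nsq_f_ge0 f)). Qed.

Lemma norm2_le_ge0 f c : norm2_le f c -> 0 <= c.
Proof. by move=> /(_ 0%N); apply/le_trans/symsum_ge0/nsq_f_ge0. Qed.

Lemma sqsD f g : square_summable f -> square_summable g ->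
  square_summable (fun k => f k + g k).
Proof.
move=> [c fc] [d gd]; exists (2 * (c + d)) => n.
apply: (@le_trans _ _ (symsum (fun k => 2 * (nsq (f k) + nsq (g k))) n)).
  by apply: le_symsum => k; exact: nsq_add.
by rewrite symsumZ symsumD ler_wpM2l// lerD ?fc ?gd.
Qed.

Lemma norm2_leZ a f c : norm2_le f c -> norm2_le (fun k => a * f k) (nsq a * c).
Proof.
move=> fc n.
rewrite (@eq_symsum _ _ (fun k => nsq a * nsq (f k))); last first.
  by move=> k /=; rewrite nsqM.
by rewrite symsumZ ler_wpM2l ?nsq_ge0.
Qed.

Lemma sqsZ a f : square_summable f -> square_summable (fun k => a * f k).
Proof. by move=> [c fc]; exists (nsq a * c); exact: norm2_leZ. Qed.

Lemma le_sqs f g : (forall k, nsq (f k) <= nsq (g k)) -> square_summable g ->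
  square_summable f.
Proof.
move=> fg [c gc]; exists c => n; apply: le_trans (gc n).
exact: le_symsum.
Qed.

Lemma sqs_conj f : square_summable f -> square_summable (fun k => (f k)^*).
Proof. by apply: le_sqs => k; rewrite nsq_conj. Qed.

Lemma sqs0 : square_summable (fun=> 0).
Proof. by exists 0 => n; rewrite /symsum big1// => i _; exact: nsq0. Qed.

Lemma symsum_single (a : int -> R) j n :
  (forall k, k != j -> a k = 0) -> 0 <= a j -> symsum a n <= a j.
Proof.
move=> a0 aj; rewrite /symsum.
case: (boolP (`|j| <= n)%N) => jn.
  have h : (absz (j + n%:Z)%R < n.*2.+1)%N by lia.
  rewrite (bigD1 (Ordinal h)) //= big1 ?addr0; last first.
    move=> i /eqP ij; apply: a0; apply/eqP => e; apply: ij; apply: val_inj => /=.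
    lia.
  by rewrite (_ : _ - _ = j) //=; lia.
rewrite big1 // => i _; apply: a0; apply/eqP => e.
by have := ltn_ord i; lia.
Qed.

Lemma sqs_single f j : (forall k, k != j -> f k = 0) -> square_summable f.
Proof.
move=> f0; exists (nsq (f j)) => n.
apply: (@symsum_single (nsq \o f)); last exact: nsq_ge0.
by move=> k kj /=; rewrite f0// nsq0.
Qed.

Lemma sqs_delta j : square_summable (delta j : int -> C).
Proof. by apply: (@sqs_single _ j) => k kj; rewrite /delta (negbTE kj). Qed.

Lemma sqs_update f g j : (forall k, k != j -> f k = g k) -> square_summable f ->
  square_summable g.
Proof.
move=> fg sf.
have -> : g = (fun k => f k + (if k == j then g j - f j else 0)).
  apply/funext => k; case: (altP (k =P j)) => [->|kj]; first by rewrite addrC subrK.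
  by rewrite fg// addr0.
by apply: sqsD => //; apply: (@sqs_single _ j) => k /negbTE ->.
Qed.

Lemma l2norm2_le f c : (l2norm2 setT f <= c%:E)%E <-> norm2_le f c.
Proof.
have E (X : seq int) : (\sum_(i <- X) (nsq (f i))%:E)%E = (\sum_(i <- X) nsq (f i))%:E.
  by rewrite sumEFin.
split => [h n|h].
  rewrite -lee_fin; apply: le_trans h; apply: esum_ge.
  pose t := [seq i%:Z - n%:Z | i : 'I_n.*2.+1].
  have ut : uniq t.
    by rewrite map_inj_uniq ?enum_uniq// => i j /addIr [] ij; exact: val_inj.
  exists [set` t]; first by split => //; exact: finite_seq.
  rewrite -fsbig_seq//= E lee_fin /t big_map /symsum.
  by rewrite big_enum lexx.
apply: ge_ereal_sup => _ [X [finX _] <-].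
rewrite fsbig_finite//= E lee_fin.
have uX : uniq (finmap.enum_fset (fset_set X)) by exact: finmap.fset_uniq.
have [n] := symsum_fset (nsq_f_ge0 f) uX.
by move=> /le_trans; apply.
Qed.

Definition cut (D : set int) f : int -> C := fun k => if k \in D then f k else 0.

Lemma l2norm2_cut D f : l2norm2 D f = l2norm2 setT (cut D f).
Proof.
rewrite /l2norm2 esum_mkcond; apply: eq_esum => k _.
rewrite /cut; case: ifP => // _.
by rewrite -/(nsq 0) nsq0.
Qed.

Lemma cut_id D f : (forall k, ~ D k -> f k = 0) -> cut D f = f.
Proof.
move=> f0; apply/funext => k; rewrite /cut; case: ifPn => // /negP kD.
by rewrite f0// => Dk; apply: kD; rewrite inE.
Qed.

Lemma l2onE D f : l2on D f <-> square_summable (cut D f).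
Proof.
rewrite /l2on l2norm2_cut; split => [h|[c /l2norm2_le h]]; last first.
  by apply: le_lt_trans h _; rewrite ltry.
have h0 : (0 <= l2norm2 setT (cut D f))%E.
  by apply: esum_ge0 => k _; rewrite lee_fin nsq_ge0.
exists (fine (l2norm2 setT (cut D f))); apply/l2norm2_le.
by rewrite fineK// ge0_fin_numE.
Qed.

Lemma l2P D f : l2 D f <-> (forall k, ~ D k -> f k = 0) /\ square_summable f.
Proof.
rewrite /l2/=; split => -[f0]; first by move=> /l2onE; rewrite cut_id.
by move=> s; split => //; apply/l2onE; rewrite cut_id.
Qed.

Lemma sub_l2on (D D' : set int) f : D `<=` D' -> l2on D' f -> l2on D f.
Proof.
move=> DD' /l2onE s; apply/l2onE; apply: le_sqs s => k.
rewrite /cut; case: ifPn => [/set_mem /DD' /mem_set -> //|_].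
by rewrite nsq0 nsq_ge0.
Qed.

Lemma sqs_l2on D f : square_summable f -> l2on D f.
Proof.
move=> s; apply/l2onE; apply: le_sqs s => k; rewrite /cut.
by case: ifP => // _; rewrite nsq0 nsq_ge0.
Qed.

Lemma l2onU (D D' : set int) f : l2on D f -> l2on D' f -> l2on (D `|` D') f.
Proof.
move=> /l2onE s /l2onE s'; apply/l2onE.
pose g k := cut D f k + (if k \in D then 0 else cut D' f k).
have -> : cut (D `|` D') f = g.
  apply/funext => k; rewrite /g /cut in_setU.
  by case: (k \in D); case: (k \in D') => /=; rewrite ?addr0 ?add0r.
apply: sqsD => //; apply: le_sqs s' => k.
by case: ifP => // _; rewrite nsq0 nsq_ge0.
Qed.

Lemma eq_l2on D f g : (forall k, D k -> f k = g k) -> l2on D f -> l2on D g.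
Proof.
move=> fg /l2onE; have -> : cut D f = cut D g; last by move/l2onE.
by apply/funext => k; rewrite /cut; case: ifPn => // /set_mem /fg.
Qed.

Lemma l2onD D f g : l2on D f -> l2on D g -> l2on D (fun k => f k + g k).
Proof.
move=> /l2onE s /l2onE s'; apply/l2onE.
have -> : cut D (fun k => f k + g k) = (fun k => cut D f k + cut D g k).
  by apply/funext => k; rewrite /cut; case: ifP; rewrite ?addr0.
exact: sqsD.
Qed.

Lemma l2onZ D a f : l2on D f -> l2on D (fun k => a * f k).
Proof.
move=> /l2onE s; apply/l2onE.
have -> : cut D (fun k => a * f k) = (fun k => a * cut D f k).
  by apply/funext => k; rewrite /cut; case: ifP; rewrite ?mulr0.
exact: sqsZ.
Qed.

Lemma l2on_conj D f : l2on D f -> l2on D (fun k => (f k)^*).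
Proof.
move=> /l2onE s; apply/l2onE.
have -> : cut D (fun k => (f k)^*) = (fun k => (cut D f k)^*).
  by apply/funext => k; rewrite /cut; case: ifP; rewrite ?conjC0.
exact: sqs_conj.
Qed.

(** Moving the end of a half-line changes finitely many terms. *)
Lemma l2on_Zge a b f : l2on (Zge a) f -> l2on (Zge b) f.
Proof.
have step c : l2on (Zge c) f -> l2on (Zge (c - 1)) f.
  move=> /l2onE s; apply/l2onE; apply: (sqs_update (j := c - 1) _ s) => k kc.
  rewrite /cut; congr (if _ then _ else _).
  by apply/idP/idP => /set_mem /= h; apply/mem_set; rewrite /Zge/= in h *; lia.
move=> fa.
have h n : l2on (Zge (a - n%:Z)) f.
  elim: n => [|n IH]; first by rewrite subr0.
  by rewrite -addn1 PoszD opprD addrA; exact: step.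
apply: sub_l2on (h `|a - b|%N) => k; rewrite /Zge/=; lia.
Qed.

Lemma l2on_Zle a b f : l2on (Zle a) f -> l2on (Zle b) f.
Proof.
have step c : l2on (Zle c) f -> l2on (Zle (c + 1)) f.
  move=> /l2onE s; apply/l2onE; apply: (sqs_update (j := c + 1) _ s) => k kc.
  rewrite /cut; congr (if _ then _ else _).
  by apply/idP/idP => /set_mem /= h; apply/mem_set; rewrite /Zle/= in h *; lia.
move=> fa.
have h n : l2on (Zle (a + n%:Z)) f.
  elim: n => [|n IH]; first by rewrite addr0.
  by rewrite -addn1 PoszD addrA; exact: step.
apply: sub_l2on (h `|a - b|%N) => k; rewrite /Zle/=; lia.
Qed.

End L2.
Arguments nsq {R} x.

(** * The block-diagonal factors and their unitarity *)

Section Blocks.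
Variable R : realType.
Local Notation C := R[i].
Implicit Types (a : int -> C) (f g x y : int -> C) (D : set int).

Lemma oddzB k : oddz (k - 1) = ~~ oddz k.
Proof.
rewrite /oddz; case: (intP k) => [//|n|n].
  by rewrite (_ : _ - 1 = n%:Z) /= ?negbK//; lia.
by rewrite (_ : - n.+1%:Z - 1 = - n.+2%:Z) ?abszN//; lia.
Qed.

Lemma oddzD k : oddz (k + 1) = ~~ oddz k.
Proof. by rewrite -{2}(addrK 1 k) oddzB negbK. Qed.

Lemma rho_sq (c : C) : rho c ^+ 2 = 1 - c * c^*.
Proof. by rewrite /rho sqrtCK normCK. Qed.

Lemma rho_conj (c : C) : rho c^* = rho c.
Proof. by rewrite /rho norm_conjC. Qed.

Lemma conj_rho (c : C) : `|c| <= 1 -> (rho c)^* = rho c.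
Proof.
move=> c1; apply: geC0_conj; rewrite /rho sqrtC_ge0 subr_ge0.
by rewrite exprn_ile1.
Qed.

Lemma rho_eq0 (c : C) : `|c| = 1 -> rho c = 0.
Proof. by move=> c1; rewrite /rho c1 expr1n subrr sqrtC0. Qed.

Lemma rho_neq0 (c : C) : `|c| < 1 -> rho c != 0.
Proof.
by move=> c1; rewrite /rho sqrtC_eq0 gt_eqF// subr_gt0 expr_lt1.
Qed.

(** [block_op b a] is determined by such equations, one for each index of
    parity [b]. This relational form treats both rows of a block at once, and
    lets operators be computed by guessing the image. *)
Definition block_eq a (k : int) x y :=
  - a k * x (k - 1) + rho (a k) * x k = y (k - 1) /\
  rho (a k) * x (k - 1) + (a k)^* * x k = y k.

Lemma block_opP b a x y :
  block_op b a x = y <-> forall k, oddz k = b -> block_eq a k x y.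
Proof.
split => [<- k kb|h].
  rewrite /block_eq /block_op oddzB kb eqxx subrK.
  have /negbTE-> : ~~ (~~ b == b) by case: b {kb}.
  by rewrite /Theta /mx2 !mxE.
apply/funext => k; rewrite /block_op; case: ifPn => [/eqP /h [_ <-]|kb].
  by rewrite /Theta /mx2 !mxE.
have : oddz (k + 1) = b by rewrite oddzD; case: b kb {h}; case: oddz.
by move=> /h []; rewrite addrK => <- _; rewrite /Theta /mx2 !mxE.
Qed.

Lemma block_op_block_eq b a x k : oddz k = b -> block_eq a k x (block_op b a x).
Proof. by have /block_opP := erefl (block_op b a x); apply. Qed.

Lemma block_eq_dot a k x y x' y' : `|a k| <= 1 -> block_eq a k x y ->
  block_eq a k x' y' ->
  (y (k - 1))^* * y' (k - 1) + (y k)^* * y' k =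
  (x (k - 1))^* * x' (k - 1) + (x k)^* * x' k.
Proof.
move=> a1 [<- <-] [<- <-].
rewrite !rmorphD !rmorphM !rmorphN /= conjCK conj_rho//.
have := rho_sq (a k).
move: (x (k - 1))^* (x k)^* (x' (k - 1)) (x' k) (a k) (a k)^* (rho _).
move=> u v u' v' s sc r rs.
transitivity (u * u' * (r ^+ 2 + s * sc) + v * v' * (r ^+ 2 + s * sc)); first by ring.
by rewrite rs subrK !mulr1.
Qed.

(** The adjoint of [Theta c] is [Theta] of the conjugate of [c], so the
    inverse of a block-diagonal factor is again of the form [block_op]. *)
Lemma block_eq_conj a k x y : block_eq a k x y -> block_eq (fun k => (a k)^*) k y x.
Proof.
rewrite /block_eq => -[<- <-]; rewrite rho_conj conjCK.
have := rho_sq (a k).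
move: (x (k - 1)) (x k) (a k) (a k)^* (rho _) => u v s sc r rs.
split.
  transitivity (u * (r ^+ 2 + s * sc)); first by ring.
  by rewrite rs subrK mulr1.
transitivity (v * (r ^+ 2 + s * sc)); first by ring.
by rewrite rs subrK mulr1.
Qed.

Definition conjs a : int -> C := fun k => (a k)^*.

Lemma block_op_conjK b a x : block_op b (conjs a) (block_op b a x) = x.
Proof. by apply/block_opP => k kb; apply: block_eq_conj; exact: block_op_block_eq. Qed.

Lemma conjsK a : conjs (conjs a) = a.
Proof. by apply/funext => k; rewrite /conjs conjCK. Qed.

Lemma block_opK b a x : block_op b a (block_op b (conjs a) x) = x.
Proof. by rewrite -{1}[a]conjsK block_op_conjK. Qed.

(** The defect of the inner product at [k] is a difference of this boundary
    term: the two defects in a block cancel each other by unitarity. *)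
Definition flux b x x' y y' (k : int) : C :=
  if oddz k == b then 0 else (y k)^* * y' k - (x k)^* * x' k.

Lemma fluxP b a x x' k : (forall k, `|a k| <= 1) ->
  let y := block_op b a x in let y' := block_op b a x' in
  (y k)^* * y' k = (x k)^* * x' k + (flux b x x' y y' k - flux b x x' y y' (k - 1)).
Proof.
move=> a1 /=; rewrite /flux oddzB.
case: (altP (oddz k =P b)) => kb; last first.
  have -> : ~~ oddz k == b by case: b kb; case: oddz.
  by rewrite subr0 addrC subrK.
have /negbTE-> : ~~ (~~ oddz k == b) by rewrite kb; case: b {kb}.
have := block_eq_dot (a1 k) (block_op_block_eq a x kb) (block_op_block_eq a x' kb).
set A := _ * _; set B := _ * _; set E := _ * _; set F := _ * _ => ABEF.
by rewrite sub0r opprB addrA [F + E]addrC -ABEF addrC addKr.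
Qed.

Lemma symsum_block_op b a x x' n : (forall k, `|a k| <= 1) ->
  let y := block_op b a x in let y' := block_op b a x' in
  symsum (fun k => (y k)^* * y' k) n = symsum (fun k => (x k)^* * x' k) n +
   (flux b x x' y y' n%:Z - flux b x x' y y' (- n%:Z - 1)).
Proof.
move=> a1 y y'; rewrite -symsum_telescope -symsumD.
by apply: eq_symsum => k; exact: fluxP.
Qed.

Lemma nsq_conjM (c : C) : c^* * c = (nsq c)%:C%C.
Proof. by rewrite nsqE mulrC. Qed.

Lemma symsum_nsq f n :
  symsum (fun k => (f k)^* * f k) n = (symsum (nsq \o f) n)%:C%C.
Proof. by rewrite /symsum rmorph_sum; apply: eq_bigr => i _; rewrite nsq_conjM. Qed.

(** The flux through the ends of [-n, n] is at most the contribution of the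
    two neighbouring sites, by unitarity of the two blocks that the interval
    may cut. *)
Lemma norm2_le_block_op b a f c : (forall k, `|a k| <= 1) ->
  norm2_le f c -> norm2_le (block_op b a f) c.
Proof.
move=> a1 fc n; apply: le_trans (fc n.+1).
rewrite -lecR -!symsum_nsq symsum_block_op// symsumS lerD//.
set y := block_op b a f.
have h k : (y k)^* * y k = (nsq (y k))%:C%C by rewrite nsq_conjM.
rewrite lerD//.
  rewrite /flux; case: ifPn => kb; first by rewrite nsq_conjM ler0c nsq_ge0.
  have kb' : oddz (n%:Z + 1) = b by rewrite oddzD; case: b kb {y h}; case: oddz.
  have := block_eq_dot (a1 _) (block_op_block_eq a f kb') (block_op_block_eq a f kb').
  rewrite -/y addrK (_ : n%:Z + 1 = n.+1%:Z); last by lia.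
  rewrite !nsq_conjM -!rmorphD => /complexI e.
  by rewrite -rmorphB lecR; have := nsq_ge0 (y n.+1%:Z); lra.
rewrite (_ : - n%:Z - 1 = - n.+1%:Z); last by lia.
rewrite /flux; case: ifPn => kb; first by rewrite oppr0 nsq_conjM ler0c nsq_ge0.
rewrite !nsq_conjM opprB -rmorphB lecR.
by have := nsq_ge0 (y (- n.+1%:Z)); lra.
Qed.

(** A block with a unimodular coefficient is diagonal, so it does not link the
    sites [k - 1] and [k]; every other block has to lie on one side of [D]. *)
Definition reducing D a := forall k, `|a k| = 1 \/ (D (k - 1) <-> D k).

Definition vanishes_off D f := forall k, ~ D k -> f k = 0.

Lemma vanishes_off_block_op D b a f : reducing D a -> vanishes_off D f ->
  vanishes_off D (block_op b a f).
Proof.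
move=> rD f0 k kD; rewrite /block_op /Theta /mx2 !mxE /= (f0 k)//.
case: ifP => _.
  case: (rD k) => [/rho_eq0 ->|e]; first by rewrite mul0r mulr0 addr0.
  by rewrite f0 ?mulr0 ?addr0// => /e.
case: (rD (k + 1)) => [/rho_eq0 ->|]; first by rewrite mul0r mulr0 addr0.
by rewrite addrK => e; rewrite (f0 (k + 1)) ?mulr0 ?addr0// => /e.
Qed.

Lemma block_op_linear b a f g (c : C) :
  block_op b a (fun k => f k + c * g k) =
  (fun k => block_op b a f k + c * block_op b a g k).
Proof. by apply/funext => k; rewrite /block_op; case: ifP => _; ring. Qed.

Definition pointwise_cvg (F : nat -> int -> C) (f : int -> C) :=
  forall k, (F n k : C^o) @[n --> \oo] --> (f k : C^o).

Lemma pointwise_cvg_block_op b a F f : pointwise_cvg F f ->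
  pointwise_cvg (fun n => block_op b a (F n)) (block_op b a f).
Proof.
move=> Ff k; rewrite /block_op.
by case: ifP => _; apply: cvgD; apply: cvgMr; exact: Ff.
Qed.

(** What a Neumann series in [B] needs: convergence is entrywise, so besides
    the contraction property (for all upper bounds of the squared norm) an
    entrywise continuity is required. It holds for operators each of whose
    matrix rows is finite. *)
Record local_contraction D (B : (int -> C) -> (int -> C)) : Prop := LocalContraction {
  lc_lin : forall f g c,
    B (fun k => f k + c * g k) = (fun k => B f k + c * B g k);
  lc_cvg : forall F f, pointwise_cvg F f -> pointwise_cvg (B \o F) (B f);
  lc_norm2_le : forall f c, norm2_le f c -> norm2_le (B f) c;
  lc_vanish : forall f, vanishes_off D f -> vanishes_off D (B f) }.

Lemma lc_block_op D b a : (forall k, `|a k| <= 1) -> reducing D a ->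
  local_contraction D (block_op b a).
Proof.
move=> a1 rD; split.
- by move=> f g c; exact: block_op_linear.
- by move=> F f; exact: pointwise_cvg_block_op.
- by move=> f c; exact: norm2_le_block_op.
- by move=> f; exact: vanishes_off_block_op.
Qed.

Lemma lc_comp D A B : local_contraction D A -> local_contraction D B ->
  local_contraction D (A \o B).
Proof.
move=> [A1 A2 A3 A4] [B1 B2 B3 B4]; split.
- by move=> f g c /=; rewrite B1 A1.
- by move=> F f /B2 /A2.
- by move=> f c /B3 /A3.
- by move=> f /B4 /A4.
Qed.

Definition CMVi a := block_op true (conjs a) \o block_op false (conjs a).

Lemma CMVK a f : CMVi a (CMV a f) = f.
Proof. by rewrite /CMVi /CMV /Vop /Wop /= !block_op_conjK. Qed.

Lemma CMViK a f : CMV a (CMVi a f) = f.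
Proof. by rewrite /CMVi /CMV /Vop /Wop /= !block_opK. Qed.

Lemma lc_CMV D a : (forall k, `|a k| <= 1) -> reducing D a ->
  local_contraction D (CMV a).
Proof. by move=> a1 rD; apply: lc_comp; exact: lc_block_op. Qed.

Lemma lc_CMVi D a : (forall k, `|a k| <= 1) -> reducing D a ->
  local_contraction D (CMVi a).
Proof.
move=> a1 rD; apply: lc_comp; apply: lc_block_op => k.
- by rewrite /conjs norm_conjC.
- by rewrite /conjs norm_conjC; exact: rD.
- by rewrite /conjs norm_conjC.
- by rewrite /conjs norm_conjC; exact: rD.
Qed.

End Blocks.

(** * Limits of complex sequences *)

Section ComplexLimits.
Variable R : realType.
Local Notation C := R[i].
Local Notation Re := (@complex.Re R).
Local Notation Im := (@complex.Im R).
Local Notation normc := (@Normc.normc R).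

Lemma cvgCP (u : nat -> C) (l : C) :
  ((u n : C^o) @[n --> \oo] --> (l : C^o)) <->
  forall e : R, 0 < e -> \forall n \near \oo, normc (l - u n) < e.
Proof.
split => [/cvgrPdist_lt h e e0|h].
  have := h e%:C%C; rewrite ltcR => /(_ e0).
  by apply: filterS => n; rewrite -normc_norm ltcR.
apply/cvgrPdist_lt => -[e e'] /=; rewrite ltcE /= => /andP[/eqP e'0 e0].
apply: filterS (h e e0) => n /= H.
by rewrite -normc_norm e'0 ltcR.
Qed.

Lemma normc_Re (x : C) : `|Re x| <= normc x.
Proof.
case: x => a b /=; rewrite -sqrtr_sqr ler_sqrt; last by rewrite addr_ge0 ?sqr_ge0.
by rewrite lerDl sqr_ge0.
Qed.

Lemma normc_Im (x : C) : `|Im x| <= normc x.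
Proof.
case: x => a b /=; rewrite -sqrtr_sqr ler_sqrt; last by rewrite addr_ge0 ?sqr_ge0.
by rewrite lerDr sqr_ge0.
Qed.

Lemma normc_ReIm (x : C) : normc x <= `|Re x| + `|Im x|.
Proof.
have := nsq_ReIm x; rewrite /nsq => h.
rewrite -[leLHS]ger0_norm ?normc_ge0// -[leRHS]ger0_norm ?addr_ge0//.
rewrite -ler_sqr ?nnegrE// !real_normK ?num_real// h sqrrD !real_normK ?num_real//.
by rewrite lerD2r lerDl mulrn_wge0 ?mulr_ge0.
Qed.

Lemma ReB (x y : C) : Re (x - y) = Re x - Re y.
Proof. by case: x; case: y. Qed.

Lemma ImB (x y : C) : Im (x - y) = Im x - Im y.
Proof. by case: x; case: y. Qed.

Lemma ReD (x y : C) : Re (x + y) = Re x + Re y.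
Proof. by case: x; case: y. Qed.

Lemma ImD (x y : C) : Im (x + y) = Im x + Im y.
Proof. by case: x; case: y. Qed.

Lemma Re_series (a : nat -> C) n : Re (series a n) = series (Re \o a) n.
Proof.
rewrite /series /=; elim: n => [|n IH]; first by rewrite !big_nil.
by rewrite !big_nat_recr //= ReD IH.
Qed.

Lemma Im_series (a : nat -> C) n : Im (series a n) = series (Im \o a) n.
Proof.
rewrite /series /=; elim: n => [|n IH]; first by rewrite !big_nil.
by rewrite !big_nat_recr //= ImD IH.
Qed.

Lemma cvgC_ReIm (u : nat -> C) (l : C) :
  ((u n : C^o) @[n --> \oo] --> (l : C^o)) <->
  (Re (u n) @[n --> \oo] --> Re l) /\ (Im (u n) @[n --> \oo] --> Im l).
Proof.
split => [/cvgCP h|[/cvgrPdist_lt h1 /cvgrPdist_lt h2]].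
  split; apply/cvgrPdist_lt => e /h; apply: filterS => n; apply: le_lt_trans.
    by rewrite -ReB normc_Re.
  by rewrite -ImB normc_Im.
apply/cvgCP => e e0; have e2 : 0 < e / 2 by rewrite divr_gt0.
near=> n; apply: le_lt_trans (normc_ReIm _) _.
rewrite ReB ImB (splitr e) ltrD//; near: n; [exact: h1|exact: h2].
Unshelve. all: by end_near. Qed.

Lemma cvg_nsq (u : nat -> C) (l : C) :
  ((u n : C^o) @[n --> \oo] --> (l : C^o)) -> nsq (u n) @[n --> \oo] --> nsq l.
Proof.
move=> /cvgC_ReIm[h1 h2]; rewrite nsq_ReIm.
rewrite (_ : (fun n => _) = (fun n => Re (u n) * Re (u n) + Im (u n) * Im (u n))).
  by rewrite !expr2; apply: cvgD; apply: cvgM.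
by apply/funext => n; rewrite nsq_ReIm !expr2.
Qed.

Lemma cvgC_unique (u : nat -> C) (l l' : C) :
  ((u n : C^o) @[n --> \oo] --> (l : C^o)) ->
  ((u n : C^o) @[n --> \oo] --> (l' : C^o)) -> l = l'.
Proof. by move=> h h'; apply: (@cvg_unique _ (@norm_hausdorff C C^o) _ _ _ _ h h'). Qed.

Lemma is_cvg_geometric_dominated (a : nat -> C) (K r : R) : 0 <= r < 1 ->
  (forall n, normc (a n) <= K * r ^+ n) ->
  cvgn (series (a : nat -> C^o)).
Proof.
move=> /andP[r0 r1] ha.
have H (b : nat -> R) : (forall n, `|b n| <= normc (a n)) -> cvgn (series b).
  move=> hb; apply: normed_cvg.
  apply: (@series_le_cvg _ _ (geometric K r)) => //=.
  - by move=> n; apply: le_trans (ha n); rewrite normc_ge0.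
  - by move=> n; apply: le_trans (ha n).
  - by apply: is_cvg_geometric_series; rewrite ger0_norm.
have /cvg_ex[x hx] := H (Re \o a) (fun n => normc_Re _).
have /cvg_ex[y hy] := H (Im \o a) (fun n => normc_Im _).
apply/cvg_ex; exists (Complex x y); apply/cvgC_ReIm; split => /=.
  by under eq_fun do rewrite Re_series.
by under eq_fun do rewrite Im_series.
Qed.

End ComplexLimits.

(** * Neumann series *)

Section Neumann.
Variable R : realType.
Local Notation C := R[i].
Local Notation normc := (@Normc.normc R).
Implicit Types (f g h : int -> C) (D : set int).

Lemma norm2_le_lim (F : nat -> int -> C) f c :
  (forall n, norm2_le (F n) c) -> pointwise_cvg F f -> norm2_le f c.
Proof.
move=> Fc Ff m.
have H : symsum (nsq \o F n) m @[n --> \oo] --> symsum (nsq \o f) m.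
  rewrite /symsum; apply: cvg_big => [x|i _]; last exact/cvg_nsq/Ff.
  exact: add_continuous.
rewrite -(cvg_lim _ H)//; apply: limr_le; first exact: cvgP H.
by apply: nearW => n; exact: Fc.
Qed.

Lemma norm2_le_trans f c d : c <= d -> norm2_le f c -> norm2_le f d.
Proof. by move=> cd fc n; exact: le_trans (fc n) cd. Qed.

Lemma normcX (x : C) n : normc (x ^+ n) = normc x ^+ n.
Proof.
elim: n => [|n IH]; first by rewrite !expr0 Normc.normc1.
by rewrite !exprS Normc.normcM IH.
Qed.

Variables (D : set int) (B : (int -> C) -> (int -> C)).
Hypothesis lcB : local_contraction D B.

Lemma lc0 : B (fun=> 0) = (fun=> 0).
Proof.
have := lc_lin lcB (fun=> 0) (fun=> 0) (-1).
rewrite (_ : (fun k : int => 0 + -1 * 0) = fun=> 0 :> C).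
  by move=> ->; apply/funext => k; rewrite mulN1r subrr.
by apply/funext => k; rewrite mulr0 addr0.
Qed.

Lemma lcZ f c : B (fun k => c * f k) = (fun k => c * B f k).
Proof.
have := lc_lin lcB (fun=> 0) f c; rewrite lc0.
by under eq_fun do rewrite add0r; under [RHS]eq_fun do rewrite add0r.
Qed.

Lemma lc_sqs f : square_summable f -> square_summable (B f).
Proof. by move=> [c fc]; exists c; exact: (lc_norm2_le lcB). Qed.

Definition neumann_term (w : C) h k : nat -> C := fun n => iter n B h k * w ^+ n.

Definition neumann w h (k : int) : C :=
  lim ((series (neumann_term w h k) : nat -> C^o) @ \oo).

Definition neumann_part w h (n : nat) (k : int) : C :=
  series (neumann_term w h k) n.

(** The partial sums are the iterates of [g |-> h + w B g]. *)
Lemma neumann_partS w h n : neumann_part w h n.+1 =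
  (fun k => h k + w * B (neumann_part w h n) k).
Proof.
elim: n => [|n IH].
  apply/funext => k; rewrite /neumann_part /series /= big_nat1.
  rewrite (_ : (fun k => _) = fun=> 0); last by apply/funext => j; rewrite big_geq.
  by rewrite lc0 /neumann_term mulr0 addr0 expr0 mulr1.
apply/funext => k.
rewrite /neumann_part {1}/series /= big_nat_recr //=.
rewrite -[X in X + _]/(neumann_part w h n.+1 k).
rewrite [in LHS]IH -addrA; congr (_ + _).
rewrite [in RHS](_ : (fun k => _) =
   (fun k => neumann_part w h n k + w ^+ n * iter n B h k)); last first.
  apply/funext => j; rewrite /neumann_part /series /= big_nat_recr//=.
  by rewrite {2}/neumann_term [w ^+ n * _]mulrC.
rewrite (lc_lin lcB) mulrDr; congr (_ + _).
by rewrite /neumann_term iterS exprS mulrC mulrA.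
Qed.

Section Fixed.
Variable w : C.
Hypothesis w1 : normc w < 1.
Let K : R := (1 - normc w) ^- 2.

Lemma iter_norm2_le h c n : norm2_le h c -> norm2_le (iter n B h) c.
Proof. by move=> hc; elim: n => //= n; exact: (lc_norm2_le lcB). Qed.

Lemma neumann_cvg h : square_summable h ->
  pointwise_cvg (neumann_part w h) (neumann w h).
Proof.
move=> [c hc] k; rewrite /neumann.
suff : cvgn (series (neumann_term w h k : nat -> C^o)) by move=> H; exact: H.
apply: (@is_cvg_geometric_dominated _ _ (Num.sqrt c) (normc w)) => [|n].
  by rewrite normc_ge0.
rewrite /neumann_term Normc.normcM normcX ler_wpM2r ?exprn_ge0 ?normc_ge0//.
rewrite -[leLHS]ger0_norm ?normc_ge0// -sqrtr_sqr ler_sqrt; last exact: norm2_le_ge0 hc.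
exact: (norm2_le_term k (iter_norm2_le n hc)).
Qed.

Lemma norm2_le_convex f g c d : norm2_le f c -> norm2_le g d ->
  norm2_le (fun k => f k + w * g k) (c / (1 - normc w) + normc w * d).
Proof.
move=> fc gd n.
apply: (@le_trans _ _ (symsum (fun k => (1 - normc w)^-1 * nsq (f k) + normc w *
  nsq (g k)) n)).
  apply: le_symsum => k; rewrite [_^-1 * _]mulrC; exact: nsq_convex.
rewrite symsumD !symsumZ lerD//.
  by rewrite mulrC ler_wpM2r ?fc// invr_ge0 subr_ge0 ltW.
by rewrite ler_wpM2l ?gd ?normc_ge0.
Qed.

(** With the constant [K = (1 - |w|) ^- 2], [norm2_le_convex] turns a bound by
    [K * c] into [c / (1 - |w|) + |w| * (K * c)], which is again [K * c]. *)
Lemma neumann_part_norm2_le h c n : norm2_le h c ->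
  norm2_le (neumann_part w h n) (K * c).
Proof.
have w1' : 0 < 1 - normc w by rewrite subr_gt0.
move=> hc; elim: n => [|n IH].
  move=> m; rewrite /symsum big1; first by rewrite mulr_ge0
    ?(norm2_le_ge0 hc)// invr_ge0 sqr_ge0.
  by move=> i _; rewrite /= /neumann_part /series /= big_geq// nsq0.
rewrite neumann_partS.
have := norm2_le_convex hc (lc_norm2_le lcB IH).
apply: norm2_le_trans; rewrite /K -subr_ge0.
rewrite [X in 0 <= X](_ : _ = 0)//; field; exact: lt0r_neq0.
Qed.

Lemma neumann_norm2_le h c : norm2_le h c -> norm2_le (neumann w h) (K * c).
Proof.
move=> hc; apply: (@norm2_le_lim (neumann_part w h)) => [n|].
  exact: neumann_part_norm2_le.
by apply: neumann_cvg; exists c.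
Qed.

Lemma neumannE h : square_summable h ->
  neumann w h = (fun k => h k + w * B (neumann w h) k).
Proof.
move=> sh; apply/funext => k.
have H := neumann_cvg sh.
apply: (@cvgC_unique _ (fun n => neumann_part w h n.+1 k)).
  by have := H k; rewrite -(cvg_shiftS (fun n => (neumann_part w h n k : C^o))).
rewrite (_ : (fun n => _) = (fun n => h k + w * B (neumann_part w h n) k)).
  apply: cvgD; first exact: cvg_cst.
  apply: cvgMr; exact: (lc_cvg lcB H).
by apply/funext => n; rewrite neumann_partS.
Qed.

Lemma neumann_vanishes_off h : square_summable h -> vanishes_off D h ->
  vanishes_off D (neumann w h).
Proof.
move=> sh h0 k kD.
apply: (@cvgC_unique _ (fun n => neumann_part w h n k)); first exact: neumann_cvg.
rewrite (_ : (fun n => _) = fun=> 0); first exact: cvg_cst.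
apply/funext; elim => [|n IH]; first by rewrite /neumann_part /series /= big_geq.
rewrite neumann_partS h0// (lc_vanish lcB)// ?mulr0 ?addr0//.
elim: n {IH} => [|n IH] j jD; first by rewrite /neumann_part /series /= big_geq.
by rewrite neumann_partS h0// (lc_vanish lcB)// mulr0 addr0.
Qed.

(** A fixed point of [w B] has squared norm at most [|w| ^ 2] times itself. *)
Lemma neumann_unique d : square_summable d -> d = (fun k => w * B d k) -> d = fun=> 0.
Proof.
move=> [c dc] dE; apply/funext => k; apply: nsq_eq0.
have H n : norm2_le d (c * (normc w ^+ 2) ^+ n).
  elim: n => [|n IH]; first by rewrite expr0 mulr1.
  rewrite dE exprS mulrCA -/(nsq w); apply: norm2_leZ; exact: (lc_norm2_le lcB).
have : c * (normc w ^+ 2) ^+ n @[n --> \oo] --> 0.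
  rewrite -(mulr0 c); apply: cvgMr; apply: cvg_expr.
  by rewrite ger0_norm ?sqr_ge0// expr_lt1 ?normc_ge0.
move=> h; apply/eqP; rewrite eq_le nsq_ge0 andbT.
rewrite -(cvg_lim _ h)//; apply: limr_ge; first exact: cvgP h.
by apply: nearW => n; exact: norm2_le_term.
Qed.

End Fixed.
End Neumann.

(** * Resolvents and their analyticity *)

Section Resolvent.
Variable R : realType.
Local Notation C := R[i].
Local Notation normc := (@Normc.normc R).
Implicit Types (f g h : int -> C) (D : set int) (A B G : (int -> C) -> (int -> C)).

Lemma resolventP D A z : in_resolvent_set D A z ->
  is_resolvent D A z (resolvent D A z).
Proof.
move=> [G hG]; rewrite /resolvent.
exact: (@xgetPex _ (fun f => f) [set G | is_resolvent D A z G] (ex_intro _ G hG)).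
Qed.

Lemma resolvent_uniq D A z g : in_resolvent_set D A z -> l2 D g ->
  resolvent D A z (addcI A (- z) g) = g.
Proof. by move=> /resolventP[_ h _] /h[]. Qed.

(** A right inverse of [A - z] is a left inverse as soon as [A - z] is
    injective. *)
Lemma is_resolventI D A z G (K : R) : local_contraction D A ->
  (forall f c, norm2_le f c -> norm2_le (G f) (K * c)) ->
  (forall f, square_summable f -> vanishes_off D f -> vanishes_off D (G f)) ->
  (forall f, square_summable f -> addcI A (- z) (G f) = f) ->
  (forall f, square_summable f -> addcI A (- z) f = (fun=> 0) -> f = fun=> 0) ->
  is_resolvent D A z G.
Proof.
move=> nA Gb Gs AG inj.
have Gq f : square_summable f -> square_summable (G f) by move=> [c fc];
  exists (K * c); exact: Gb.
have Aq f : square_summable f -> square_summable (addcI A (- z) f).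
  by move=> sf; rewrite /addcI; apply: sqsD; [exact: (lc_sqs nA)|exact: sqsZ].
split.
- move=> f /l2P[f0 sf]; split; last exact: AG.
  by apply/l2P; split; [exact: Gs|exact: Gq].
- move=> f /l2P[f0 sf]; split.
    apply/l2P; split; last exact: Aq.
    by move=> k kD; rewrite /addcI f0// mulr0 addr0 (lc_vanish nA).
  have E := AG _ (Aq _ sf).
  have : (fun k => G (addcI A (- z) f) k + -1 * f k) = fun=> 0.
    apply: inj; first by apply: sqsD; [exact/Gq/Aq|exact: sqsZ].
    apply/funext => k; rewrite /addcI (lc_lin nA).
    have := congr1 (fun F => F k) E; rewrite /addcI => Ek.
    by rewrite mulrDr addrACA Ek; ring.
  by move=> h; apply/funext => k; have := congr1 (fun F => F k) h;
    rewrite /= mulN1r => /eqP; rewrite subr_eq0 => /eqP.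
- exists K => f /l2P[f0 sf].
  have Gf0 := Gs _ sf f0.
  rewrite l2norm2_cut [X in (_ <= _ * X)%E]l2norm2_cut !cut_id//.
  have h0 : (0 <= l2norm2 setT f)%E.
    by apply: esum_ge0 => k _; rewrite lee_fin nsq_ge0.
  have fin : l2norm2 setT f \is a fin_num.
    by rewrite ge0_fin_numE//; exact: (sqs_l2on setT sf).
  rewrite -(fineK fin) -EFinM; apply/l2norm2_le/Gb/l2norm2_le.
  by rewrite fineK.
Qed.

Variables (D : set int) (A B : (int -> C) -> (int -> C)).
Hypotheses (nA : local_contraction D A) (nB : local_contraction D B).
Hypotheses (AB : forall f, A (B f) = f) (BA : forall f, B (A f) = f).

(** [(A - z) g = f] is the fixed-point equation [g = B f + z B g], where [B]
    is the inverse of [A]. *)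
Lemma neumann_inner z : normc z < 1 ->
  is_resolvent D A z (fun f => neumann B z (B f)).
Proof.
move=> z1; apply: (is_resolventI (K := (1 - normc z) ^- 2) nA).
- by move=> f c fc; apply: (neumann_norm2_le nB z1); exact: (lc_norm2_le nB).
- move=> f sf f0; apply: (neumann_vanishes_off nB z1); first exact: (lc_sqs nB).
  exact: (lc_vanish nB).
- move=> f sf; apply/funext => k; rewrite /addcI.
  rewrite {1}(neumannE nB z1 (lc_sqs nB sf)) (lc_lin nA) !AB.
  by rewrite mulNr addrK.
- move=> f sf h; apply: (neumann_unique nB z1) => //.
  rewrite -(lcZ nB) -[LHS]BA; congr B; apply/funext => k.
  have := congr1 (fun F => F k) h; rewrite /addcI mulNr => /eqP.
  by rewrite subr_eq0 => /eqP.
Qed.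

(** [(A - z) g = f] is the fixed-point equation [g = - z^-1 f + z^-1 A g]. *)
Lemma neumann_outer z : 1 < normc z -> in_resolvent_set D A z.
Proof.
move=> z1; have z0 : z != 0.
  by apply/eqP => z0; move: z1; rewrite z0 Normc.normc0 ltr10.
have w1 : normc z^-1 < 1 by rewrite Normc.normcV invf_lt1// (lt_trans _ z1).
exists (fun f => neumann A z^-1 (fun k => - z^-1 * f k)).
apply: (is_resolventI (K := (1 - normc z^-1) ^- 2 * nsq (- z^-1)) nA).
- by move=> f c fc; rewrite -mulrA; apply: (neumann_norm2_le nA w1); exact: norm2_leZ.
- move=> f sf f0; apply: (neumann_vanishes_off nA w1); first exact: sqsZ.
  by move=> k kD; rewrite f0// mulr0.
- move=> f sf; apply/funext => k; rewrite /addcI.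
  have /(congr1 (fun F => F k)) /= E := neumannE nA w1 (sqsZ (- z^-1) sf).
  rewrite [X in - z * X]E.
  by field.
- move=> f sf h; apply: (neumann_unique nA w1) => //.
  apply/funext => k; have := congr1 (fun F => F k) h; rewrite /addcI mulNr => /eqP.
  by rewrite subr_eq0 => /eqP ->; rewrite mulKf.
Qed.

Lemma in_resolvent z : `|z| != 1 -> in_resolvent_set D A z.
Proof.
move=> z1; have : normc z != 1.
  by apply/eqP => h; move/eqP: z1; apply; rewrite -normc_norm h.
rewrite neq_lt => /orP[h|]; last exact: neumann_outer.
by eexists; exact: neumann_inner.
Qed.

Lemma l2dot_delta k f : l2dot (delta k) f = f k.
Proof.
rewrite /l2dot; apply: (@cvg_lim C^o); first exact: (@norm_hausdorff C C^o).
apply: cvg_near_cst; exists `|k|%N => // n /= kn.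
have h : (absz (k + n%:Z)%R < n.*2.+1)%N by lia.
rewrite (bigD1 (Ordinal h)) //= big1 ?addr0; last first.
  move=> i /eqP ij; rewrite /delta; case: eqP; last by rewrite conjC0 mul0r.
  by move=> e; exfalso; apply: ij; apply: val_inj => /=; lia.
rewrite /delta (_ : _ - _ = k) ?eqxx ?conjC1 ?mul1r//; lia.
Qed.

Lemma entryE G k k' : entry G k k' = G (delta k') k.
Proof. exact: l2dot_delta. Qed.

Lemma l2_delta k : D k -> l2 D (delta k : int -> C).
Proof.
move=> Dk; apply/l2P; split; last exact: sqs_delta.
by move=> j jD; rewrite /delta; case: eqP => // jk; move: jD; rewrite jk.
Qed.

(** Inside the unit disk the Neumann series in the inverse [B] is a power
    series in [z]. *)
Lemma resolvent_analytic k k' : D k' ->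
  analytic_on_disk (fun z => entry (resolvent D A z) k k').
Proof.
move=> Dk'; exists (fun n => iter n B (B (delta k')) k) => z z1.
rewrite entryE.
have w1 : normc z < 1 by rewrite -ltcR normc_norm.
have [N1 N2 _] := neumann_inner w1.
have [/= Ng Ne] := N1 _ (l2_delta Dk').
have : in_resolvent_set D A z by eexists; exact: neumann_inner.
move=> /resolvent_uniq /(_ Ng); rewrite Ne => ->.
apply: (neumann_cvg nB w1); apply: (lc_sqs nB); exact: sqs_delta.
Qed.

End Resolvent.

(** * Unitarity of CMV operators *)

Section Unitary.
Variable R : realType.
Local Notation C := R[i].
Implicit Types (a : int -> C) (f g h : int -> C) (D : set int).

Lemma cvg0_nsq (u : nat -> C) : nsq (u n) @[n --> \oo] --> (0 : R) ->
  (u n : C^o) @[n --> \oo] --> (0 : C^o).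
Proof.
move=> /cvgrPdist_lt h; apply/cvgCP => e e0.
have e2 : 0 < e ^+ 2 by rewrite exprn_gt0.
apply: filterS (h _ e2) => n; rewrite !sub0r normrN ger0_norm ?nsq_ge0//.
by rewrite -nsqN /nsq ltr_sqr ?nnegrE ?normc_ge0// ltW.
Qed.

Lemma sqs_cvg0 f : square_summable f ->
  ((f n%:Z : C^o) @[n --> \oo] --> (0 : C^o)) /\
  ((f (- n%:Z - 1) : C^o) @[n --> \oo] --> (0 : C^o)).
Proof.
move=> [c fc].
pose s n := symsum (nsq \o f) n.
have s_nd : nondecreasing_seq s.
  by apply/nondecreasing_seqP => n; rewrite /s symsumS lerDl addr_ge0// nsq_ge0.
have /cvg_ex[l sl] : cvgn s.
  by apply: nondecreasing_is_cvgn => //; exists c => _ [n _ <-]; exact: fc.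
have d0 : s n.+1 - s n @[n --> \oo] --> 0.
  rewrite -(subrr l); apply: cvgB => //.
  by rewrite (cvg_shiftS s).
have dE n : s n.+1 - s n = nsq (f n.+1%:Z) + nsq (f (- n.+1%:Z)).
  by rewrite /s symsumS addrC addKr.
split.
  rewrite -(cvg_shiftS (fun n : nat => (f n%:Z : C^o))).
  apply: cvg0_nsq.
  apply: (squeeze_cvgr _ (cvg_cst 0) d0).
  by apply: nearW => n; rewrite nsq_ge0 dE lerDl nsq_ge0.
apply: cvg0_nsq; apply: (squeeze_cvgr _ (cvg_cst 0) d0).
apply: nearW => n; rewrite nsq_ge0 dE (_ : - n%:Z - 1 = - n.+1%:Z); last by lia.
by rewrite lerDr nsq_ge0.
Qed.

Lemma cvg_conj0 (u : nat -> C) : (u n : C^o) @[n --> \oo] --> (0 : C^o) ->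
  ((u n)^* : C^o) @[n --> \oo] --> (0 : C^o).
Proof.
move=> /cvg_nsq h; apply: cvg0_nsq; rewrite -(@nsq0 R).
by under eq_cvg do rewrite nsq_conj.
Qed.

(** The two sequences have the same limits, so [lim] takes the same value on
    both, whether or not they converge. *)
Lemma l2dot_eq f g f' g' :
  (symsum (fun k => (f' k)^* * g' k) n - symsum (fun k => (f k)^* * g k) n : C^o)
    @[n --> \oo] --> (0 : C^o) -> l2dot f' g' = l2dot f g.
Proof.
move=> h; rewrite /l2dot.
pose u n : C^o := symsum (fun k => (f k)^* * g k) n.
pose v n : C^o := symsum (fun k => (f' k)^* * g' k) n.
rewrite -/u -/v /lim /lim_in.
suff H : (fun l : C^o => v @ \oo --> l) = (fun l : C^o => u @ \oo --> l).
  by congr (xget _ _); exact: H.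
apply/funext => l; apply/propext.
have {}h : (v n - u n) @[n --> \oo] --> (0 : C^o) by exact: h.
split=> H.
- rewrite -[l]subr0 [X in X @ _ --> _](_ : _ = (fun n => v n - (v n - u n)));
  last first.
    by apply/funext => n; rewrite opprB addrC subrK.
  exact: (cvgB H h).
- rewrite -[l]addr0 [X in X @ _ --> _](_ : _ = (fun n => u n + (v n - u n)));
  last first.
    by apply/funext => n; rewrite addrC subrK.
  exact: (cvgD H h).
Qed.

(** The partial sums differ by the flux through the two ends, which vanishes
    in the limit because square-summable sequences tend to zero. *)
Lemma l2dot_block_op b a f g : (forall k, `|a k| <= 1) -> square_summable f ->
  square_summable g ->
  l2dot (block_op b a f) (block_op b a g) = l2dot f g.
Proof.
move=> a1 sf sg; apply: l2dot_eq.
set y := block_op b a f; set y' := block_op b a g.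
have sy : square_summable y by case: sf => c fc; exists c; exact: norm2_le_block_op.
have sy' : square_summable y' by case: sg => c gc; exists c; exact: norm2_le_block_op.
have E n : symsum (fun k => (y k)^* * y' k) n - symsum (fun k => (f k)^* * g k) n
   = flux b f g y y' n%:Z - flux b f g y y' (- n%:Z - 1).
  by rewrite symsum_block_op// addrC addKr.
rewrite (_ : (fun n => _) =
  (fun n => flux b f g y y' n%:Z - flux b f g y y' (- n%:Z - 1))); last exact/funext.
have [f1 f2] := sqs_cvg0 sf; have [g1 g2] := sqs_cvg0 sg.
have [y1 y2] := sqs_cvg0 sy; have [y'1 y'2] := sqs_cvg0 sy'.
have H (j : nat -> int) :
   (f (j n) : C^o) @[n --> \oo] --> (0 : C^o) ->
   (g (j n) : C^o) @[n --> \oo] --> (0 : C^o) ->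
   (y (j n) : C^o) @[n --> \oo] --> (0 : C^o) ->
   (y' (j n) : C^o) @[n --> \oo] --> (0 : C^o) ->
   (flux b f g y y' (j n) : C^o) @[n --> \oo] --> (0 : C^o).
  move=> h1 h2 h3 h4.
  pose F n : C^o := (y (j n))^* * y' (j n) - (f (j n))^* * g (j n).
  have F0 : F n @[n --> \oo] --> (0 : C^o).
    rewrite -[0](subrr (0 : C^o)); apply: cvgB; rewrite -[0](mul0r (0 : C^o)).
      by apply: cvgM => //; exact: cvg_conj0.
    by apply: cvgM => //; exact: cvg_conj0.
  apply/cvgCP => e e0; move/cvgCP : F0 => /(_ e e0); apply: filterS => n.
  rewrite /flux; case: ifP => // _ _.
  by rewrite subrr Normc.normc0.
rewrite -[0](subrr (0 : C^o)); apply: cvgB.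
- exact: (H (fun n => n%:Z)).
- exact: (H (fun n => - n%:Z - 1)).
Qed.

Lemma unitary_CMV D a : (forall k, `|a k| <= 1) -> reducing D a ->
  unitary_on D (CMV a).
Proof.
move=> a1 rD.
have nA := lc_CMV a1 rD; have nB := lc_CMVi a1 rD.
split.
- move=> f /l2P[f0 sf]; apply/l2P; split; first exact: (lc_vanish nA).
  exact: (lc_sqs nA).
- move=> f g /l2P[_ sf] /l2P[_ sg]; rewrite /CMV /Vop /Wop.
  rewrite !l2dot_block_op//.
    by case: sf => c fc; exists c; exact: norm2_le_block_op.
  by case: sg => c gc; exists c; exact: norm2_le_block_op.
- move=> g /l2P[g0 sg]; exists (CMVi a g); last exact: CMViK.
  apply/l2P; split; first exact: (lc_vanish nB).
  exact: (lc_sqs nB).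
Qed.

Lemma CMV_in_resolvent D a z : (forall k, `|a k| <= 1) -> reducing D a ->
  `|z| != 1 -> in_resolvent_set D (CMV a) z.
Proof.
move=> a1 rD.
exact: (in_resolvent (lc_CMV a1 rD) (lc_CMVi a1 rD) (@CMViK _ a) (@CMVK _ a)).
Qed.

Lemma CMV_resolvent_analytic D a k k' : (forall k, `|a k| <= 1) -> reducing D a ->
  D k' -> analytic_on_disk (fun z => entry (resolvent D (CMV a) z) k k').
Proof.
move=> a1 rD.
exact: (resolvent_analytic (lc_CMV a1 rD) (lc_CMVi a1 rD) (@CMViK _ a) (@CMVK _ a)).
Qed.

End Unitary.

(** * Block equations and Green functions *)

Section Sol.
Variable R : realType.
Local Notation C := R[i].
Implicit Types (a b : int -> C) (f u v x y : int -> C) (z c : C) (k : int).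

Lemma block_opZ p a f c k :
  block_op p a (fun k => c * f k) k = c * block_op p a f k.
Proof. by rewrite /block_op; case: ifP => _; ring. Qed.

Lemma block_eq_scale s a k x y : block_eq a k x y ->
  block_eq a k (fun j => x j * s) (fun j => y j * s).
Proof. by rewrite /block_eq => -[<- <-]; split; ring. Qed.

Lemma eq_block_eq a k x y x' y' : x (k - 1) = x' (k - 1) -> x k = x' k ->
  y (k - 1) = y' (k - 1) -> y k = y' k -> block_eq a k x y -> block_eq a k x' y'.
Proof. by rewrite /block_eq => -> -> -> ->. Qed.

(** The block of index [k] in the system [W u = z v], [V v = u], which factors
    [U u = z u] into one equation for each block. *)
Definition block_eqs a z k u v : Prop :=
  if oddz k then block_eq a k u (fun j => z * v j) else block_eq a k v u.

Lemma block_eqs_CMV a z u v : (forall k, block_eqs a z k u v) ->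
  CMV a u = fun k => z * u k.
Proof.
move=> h; rewrite /CMV.
have -> : Wop a u = fun k => z * v k.
  by apply/block_opP => k ko; have := h k; rewrite /block_eqs ko.
have V : Vop a v = u.
  by apply/block_opP => k ko; have := h k; rewrite /block_eqs ko.
rewrite -[u in RHS]V; apply/block_opP => k ke.
have := block_op_block_eq a v ke; rewrite -/(Vop a v) => -[h1 h2]; split.
  by rewrite -h1; ring.
by rewrite -h2; ring.
Qed.

(** A square-summable solution is an eigenvector of a unitary operator for an
    eigenvalue off the unit circle. *)
Lemma block_eqs_l2_eq0 a z u v : (forall k, `|a k| <= 1) -> `|z| != 1 -> z != 0 ->
  (forall k, block_eqs a z k u v) -> square_summable u -> forall k, u k = 0 /\ v k = 0.
Proof.
move=> a1 z1 z0 h su.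
have rT : reducing setT a by move=> k; right.
have res := CMV_in_resolvent a1 rT z1.
have l0 : l2 setT ((fun=> 0) : int -> C) by apply/l2P; split => //; exact: sqs0.
have lu : l2 setT u by apply/l2P; split => // k [].
have u0 : u = fun=> 0.
  rewrite -(resolvent_uniq res lu) -[RHS](resolvent_uniq res l0);
    congr (resolvent _ _ _ _).
  apply/funext => k; rewrite /addcI (block_eqs_CMV h) mulNr subrr.
  rewrite (lc0 (lc_CMV a1 rT)) mulr0 addr0 //.
have hW : Wop a u = fun k => z * v k.
  by apply/block_opP => j jo; have := h j; rewrite /block_eqs jo.
have zv k : z * v k = 0.
  rewrite -[LHS]/((fun k => z * v k) k) -hW /Wop u0.
  by rewrite (lc0 (lc_block_op true a1 rT)).
move=> k; split; first by rewrite u0.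
by have /eqP := zv k; rewrite mulf_eq0 (negbTE z0) => /eqP.
Qed.

(** What the block of index [k1] says about the site [k1] once its coefficient
    [b k1] is unimodular. *)
Definition bc_right b z k1 u v :=
  if oddz k1 then (b k1)^* * u k1 = z * v k1 else (b k1)^* * v k1 = u k1.
(** What the block of index [k1] says about the site [k1 - 1] once its
    coefficient [b k1] is unimodular. *)
Definition bc_left b z k1 u v :=
  if oddz k1 then - b k1 * u (k1 - 1) = z * v (k1 - 1)
  else - b k1 * v (k1 - 1) = u (k1 - 1).

Lemma mem_Zge k1 k : (k \in Zge k1) = (k1 <= k).
Proof. by apply/idP/idP => [/set_mem|h]//; exact/mem_set. Qed.
Lemma mem_Zle k1 k : (k \in Zle k1) = (k <= k1).
Proof. by apply/idP/idP => [/set_mem|h]//; exact/mem_set. Qed.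

Lemma block_eqs_cut_right a b z k1 u v :
  `|b k1| = 1 -> (forall k, k != k1 -> b k = a k) ->
  (forall k, k1 < k -> block_eqs a z k u v) -> bc_right b z k1 u v ->
  forall k, block_eqs b z k (cut (Zge k1) u) (cut (Zge k1) v).
Proof.
move=> b1 ba h bc k; case: (ltrgtP k k1) => kk1.
- rewrite /block_eqs /block_eq /cut !mem_Zge (_ : (k1 <= k) = false); last by lia.
  rewrite (_ : (k1 <= k - 1) = false); last by lia.
  by case: ifP => _; rewrite !mulr0 addr0.
- have := h k kk1; rewrite /block_eqs /block_eq /cut !mem_Zge.
  rewrite (_ : (k1 <= k) = true); last by lia.
  rewrite (_ : (k1 <= k - 1) = true); last by lia.
  by rewrite ba //; lia.
- rewrite kk1 /block_eqs /block_eq /cut !mem_Zge lexx.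
  rewrite (_ : (k1 <= k1 - 1) = false); last by lia.
  move: bc; rewrite /bc_right rho_eq0//.
  by case: ifP => _ ->; rewrite !mulr0 !mul0r ?add0r ?addr0.
Qed.

Lemma block_eqs_cut_left a b z k1 u v :
  `|b k1| = 1 -> (forall k, k != k1 -> b k = a k) ->
  (forall k, k < k1 -> block_eqs a z k u v) -> bc_left b z k1 u v ->
  forall k, block_eqs b z k (cut (Zle (k1 - 1)) u) (cut (Zle (k1 - 1)) v).
Proof.
move=> b1 ba h bc k; case: (ltrgtP k k1) => kk1.
- have := h k kk1; rewrite /block_eqs /block_eq /cut !mem_Zle.
  rewrite (_ : (k <= k1 - 1) = true); last by lia.
  rewrite (_ : (k - 1 <= k1 - 1) = true); last by lia.
  by rewrite ba //; lia.
- rewrite /block_eqs /block_eq /cut !mem_Zle (_ : (k <= k1 - 1) = false); last by lia.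
  rewrite (_ : (k - 1 <= k1 - 1) = false); last by lia.
  by case: ifP => _; rewrite !mulr0 addr0.
- rewrite kk1 /block_eqs /block_eq /cut !mem_Zle lexx.
  rewrite (_ : (k1 <= k1 - 1) = false); last by lia.
  move: bc; rewrite /bc_left rho_eq0//.
  by case: ifP => _ ->; rewrite !mulr0 !mul0r ?add0r ?addr0.
Qed.

Definition parity_sign k : C := if oddz k then -1 else 1.

Definition green (u1 v1 u2 v2 : int -> C) k' k : C :=
  if upper k k' then u1 k * v2 k' else u2 k * v1 k'.

(** Put [h] equal to [v1 k * v2 k'] up to [k'] and to [v2 k * v1 k'] beyond
    it. The two formulas for [h] agree at [k'], while those for [green] differ
    there by the Wronskian. The block of [W] at [k'] lies to the left of [k']
    if [k'] is odd and to the right if it is even; the convention of [upper]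
    on the diagonal makes [green] follow one single solution on that block, so
    that [W green = z h] exactly, and the jump of [green] appears as the
    source term in [V h = green + z^-1 delta]. *)
Lemma CMV_green b z c k' u1 v1 u2 v2 : z != 0 ->
  (forall k, k <= k' -> block_eqs b z k u1 v1) ->
  (forall k, k' < k -> block_eqs b z k u2 v2) ->
  c * z * (parity_sign k' * (u1 k' * v2 k' - u2 k' * v1 k')) = 1 ->
  addcI (CMV b) (- z) (fun k => c * green u1 v1 u2 v2 k' k) = delta k'.
Proof.
move=> z0 s1 s2 cN.
pose g k := c * green u1 v1 u2 v2 k' k.
pose h k := c * (if k <= k' then v1 k * v2 k' else v2 k * v1 k').
have hW : Wop b g = fun k => z * h k.
  apply/block_opP => k ko; case: (leP k k') => kk'.
    have := s1 k kk'; rewrite /block_eqs ko => /(block_eq_scale (c * v2 k')).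
    apply: eq_block_eq; rewrite /g /h /green /upper.
    - by rewrite (_ : k - 1 < k') /=; [ring|lia].
    - by rewrite ko andbT (_ : (k < k') || (k == k')); [ring|lia].
    - by rewrite (_ : k - 1 <= k'); [ring|lia].
    - by rewrite kk'; ring.
  have := s2 k kk'; rewrite /block_eqs ko => /(block_eq_scale (c * v1 k')).
  apply: eq_block_eq; rewrite /g /h /green /upper.
  - by rewrite oddzB ko andbF orbF (_ : k - 1 < k' = false); [ring|lia].
  - by rewrite (_ : k < k' = false) 1?(_ : k == k' = false) /= ?mulr0; [ring|lia|lia].
  - case: ifPn => kk''; last by ring.
    have -> : k - 1 = k' by lia.
    by ring.
  - by rewrite leNgt kk' /=; ring.
have hV : Vop b h = fun k => g k + z^-1 * delta k' k.
  apply/block_opP => k ke; case: (leP k k') => kk'.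
    have := s1 k kk'; rewrite /block_eqs ke => /(block_eq_scale (c * v2 k')).
    apply: eq_block_eq; rewrite /g /h /green /upper /delta.
    - by rewrite (_ : k - 1 <= k'); [ring|lia].
    - by rewrite kk'; ring.
    - rewrite (_ : k - 1 < k') /=; last by lia.
      by rewrite (_ : k - 1 == k' = false) ?mulr0; [ring|lia].
    - rewrite ke andbF orbF; have [kk''|kk''] := eqVneq k k'; last first.
        by rewrite (_ : k < k') ?mulr0; [ring|lia].
      rewrite kk'' ltxx /=; apply: (mulfI z0); rewrite mulr1 mulrDr divff// -cN.
      by rewrite /parity_sign -kk'' ke; ring.
  have := s2 k kk'; rewrite /block_eqs ke => /(block_eq_scale (c * v1 k')).
  apply: eq_block_eq; rewrite /g /h /green /upper /delta.
  - case: ifPn => kk''; last by ring.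
    have -> : k - 1 = k' by lia.
    by ring.
  - by rewrite leNgt kk' /=; ring.
  - rewrite oddzB ke andbT; have [kk''|kk''] := eqVneq (k - 1) k'; last first.
      by rewrite (_ : k - 1 < k' = false) /= ?mulr0; [ring|lia].
    rewrite kk'' ltxx /=; apply: (mulfI z0); rewrite mulr1 mulrDr divff// -cN.
    by rewrite /parity_sign -kk'' oddzB ke /=; ring.
  - rewrite (_ : k < k' = false) 1?(_ : k == k' = false) /= ?mulr0; [|lia|lia].
    by ring.
rewrite /addcI -/g /CMV hW; apply/funext => k.
have -> : Vop b (fun k => z * h k) k = z * Vop b h k.
  exact: block_opZ.
by rewrite hV -/(g k); field.
Qed.

End Sol.

(** * The transfer recursion *)

Section Transfer.
Variable R : realType.
Local Notation C := R[i].
Implicit Types (a b : int -> C) (w : int -> 'cV[C]_2) (z c : C) (k : int).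

Definition top w : int -> C := fun k => w k 0 0.
Definition bot w : int -> C := fun k => w k 1 0.

Definition transfer_step a z k w := w k = transfer a z k *m w (k - 1).

Lemma cv2P (x y : 'cV[C]_2) : x 0 0 = y 0 0 -> x 1 0 = y 1 0 -> x = y.
Proof.
move=> h0 h1; apply/colP => i; case: (unliftP 0 i) => [j ->|->//].
by rewrite ord1 (_ : lift 0 0 = 1)//; exact: val_inj.
Qed.

Lemma cv2E0 (x y : C) : cv2 x y 0 0 = x. Proof. by rewrite mxE. Qed.
Lemma cv2E1 (x y : C) : cv2 x y 1 0 = y. Proof. by rewrite mxE. Qed.

Lemma mulmx2E (M : 'M[C]_2) (x : 'cV[C]_2) i :
  (M *m x) i 0 = M i 0 * x 0 0 + M i 1 * x 1 0.
Proof.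
rewrite mxE big_ord_recl big_ord1; congr (_ * _ + _ * _).
  by congr (M i _); exact: val_inj.
by congr (x _ _); exact: val_inj.
Qed.

Lemma mulmx_mx2 (p q r s : C) (x : 'cV[C]_2) :
  mx2 p q r s *m x = cv2 (p * x 0 0 + q * x 1 0) (r * x 0 0 + s * x 1 0).
Proof. by apply: cv2P; rewrite mulmx2E /mx2 /cv2 !mxE. Qed.

Lemma scaleE (p : C) (x : 'cV[C]_2) i : (p *: x) i 0 = p * x i 0.
Proof. by rewrite mxE. Qed.

Definition cvE := (cv2E0, cv2E1).

Lemma transfer_stepE a z k w : transfer_step a z k w <->
  w k 0 0 = (rho (a k))^-1 *
    (if oddz k then a k * w (k - 1) 0 0 + z * w (k - 1) 1 0
     else (a k)^* * w (k - 1) 0 0 + w (k - 1) 1 0) /\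
  w k 1 0 = (rho (a k))^-1 *
    (if oddz k then z^-1 * w (k - 1) 0 0 + (a k)^* * w (k - 1) 1 0
     else w (k - 1) 0 0 + a k * w (k - 1) 1 0).
Proof.
have E i : (transfer a z k *m w (k - 1)) i 0 = if i == 0 then
     (rho (a k))^-1 * (if oddz k then a k * w (k - 1) 0 0 + z * w (k - 1) 1 0
               else (a k)^* * w (k - 1) 0 0 + w (k - 1) 1 0)
   else (rho (a k))^-1 * (if oddz k then z^-1 * w (k - 1) 0 0 + (a k)^* * w (k - 1) 1 0
               else w (k - 1) 0 0 + a k * w (k - 1) 1 0).
  by rewrite mulmx2E /transfer /mx2; case: (oddz k); rewrite !mxE /=;
    case: (i == 0); ring.
rewrite /transfer_step; split => [->|[h0 h1]]; first by rewrite !E.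
by apply: cv2P; rewrite E.
Qed.

Lemma transfer_uniq_up a z k0 w w' : (forall k, k0 < k -> transfer_step a z k w) ->
  (forall k, k0 < k -> transfer_step a z k w') -> w k0 = w' k0 ->
  forall k, k0 <= k -> w k = w' k.
Proof.
move=> h h' e k kk0.
have {kk0} -> : k = k0 + (absz (k - k0)%R)%:Z by lia.
elim: (absz _) => [|n IH]; first by rewrite addr0.
have kn : k0 < k0 + n.+1%:Z by lia.
have := h _ kn; have := h' _ kn; rewrite /transfer_step => -> ->.
have -> : k0 + n.+1%:Z - 1 = k0 + n%:Z by lia.
by rewrite IH.
Qed.

Variable (a : int -> C) (z : C).
Hypothesis ha : forall k, `|a k| < 1.
Hypothesis z0 : z != 0.

Let rho0 k : rho (a k) != 0. Proof. exact: rho_neq0. Qed.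

Let rho2 k : rho (a k) ^+ 2 = 1 - a k * (a k)^*. Proof. exact: rho_sq. Qed.

(** Each block equation is solved for its right-hand values, using [rho ^ 2 =
    1 - |a k| ^ 2]. *)
Lemma transfer_step_block_eqs k w : transfer_step a z k w <->
  block_eqs a z k (top w) (bot w).
Proof.
rewrite transfer_stepE /block_eqs /block_eq /top /bot.
have := rho0 k; have := rho2 k.
move: (a k) (a k)^* (rho _) => x xc r rs rn.
have xx : x * xc = 1 - r ^+ 2 by rewrite rs opprB addrC subrK.
move: (w (k - 1) 0 0) (w (k - 1) 1 0) (w k 0 0) (w k 1 0) => u v U V.
case: ifP => _; split => -[h1 h2].
- rewrite h1 h2; split; first by field; rewrite ?z0 ?rn.
  transitivity (r^-1 * ((r ^+ 2 + x * xc) * u + xc * z * v)); first by field;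
    rewrite ?z0 ?rn.
  by rewrite xx; field; rewrite ?z0 ?rn.
- have vE : v = z^-1 * (- x * u + r * U) by rewrite h1; field; rewrite ?z0 ?rn.
  have VE : V = z^-1 * (r * u + xc * U) by rewrite h2; field; rewrite ?z0 ?rn.
  rewrite vE VE; split; first by field; rewrite ?z0 ?rn.
  transitivity (r^-1 * z^-1 * ((1 - x * xc) * u + xc * r * U)); last by field;
    rewrite ?z0 ?rn.
  by rewrite xx; field; rewrite ?z0 ?rn.
- rewrite h1 h2; split; first by field; rewrite ?z0 ?rn.
  transitivity (r^-1 * ((r ^+ 2 + x * xc) * v + xc * u)); first by field;
    rewrite ?z0 ?rn.
  by rewrite xx; field; rewrite ?z0 ?rn.
- rewrite -h1 -h2; split; last by field; rewrite ?z0 ?rn.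
  transitivity (r^-1 * ((1 - x * xc) * v + xc * r * V)); last by field; rewrite ?z0 ?rn.
  by rewrite xx; field; rewrite ?z0 ?rn.
Qed.

(** Transfer matrices have determinant [-1]. *)
Lemma transfer_step_det k w w' : transfer_step a z k w -> transfer_step a z k w' ->
  w k 0 0 * w' k 1 0 - w' k 0 0 * w k 1 0 =
  - (w (k - 1) 0 0 * w' (k - 1) 1 0 - w' (k - 1) 0 0 * w (k - 1) 1 0).
Proof.
move=> /transfer_stepE[-> ->] /transfer_stepE[-> ->].
have := rho0 k; have := rho2 k.
move: (a k) (a k)^* (rho _) => x xc r rs rn.
have xx : x * xc = 1 - r ^+ 2 by rewrite rs opprB addrC subrK.
move: (w (k - 1) 0 0) (w (k - 1) 1 0) (w' (k - 1) 0 0) (w' (k - 1) 1 0) => u v U V.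
case: ifP => _.
- transitivity (r ^- 2 * (x * xc - 1) * (u * V - U * v)); first by field;
  rewrite ?z0 ?rn.
  by rewrite xx; field; rewrite ?z0 ?rn.
- transitivity (r ^- 2 * (x * xc - 1) * (u * V - U * v)); first by field;
  rewrite ?z0 ?rn.
  by rewrite xx; field; rewrite ?z0 ?rn.
Qed.

Definition inv_transfer k : 'M[C]_2 :=
  (rho (a k))^-1 *: (if oddz k then mx2 (- (a k)^*) z z^-1 (- a k)
     else mx2 (- a k) 1 1 (- (a k)^*)).

Lemma inv_transferK k (x : 'cV[C]_2) : inv_transfer k *m (transfer a z k *m x) = x.
Proof.
have := rho0 k; have := rho2 k.
rewrite /inv_transfer /transfer.
move: (a k) (a k)^* (rho _) => s sc r rs rn.
have ss : s * sc = 1 - r ^+ 2 by rewrite rs opprB addrC subrK.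
case: (oddz k); rewrite -!scalemxAl !mulmx_mx2; apply: cv2P;
  rewrite !scaleE !cvE.
- transitivity (r ^- 2 * (1 - s * sc) * x 0 0); first by field; rewrite ?z0 ?rn.
  by rewrite ss; field; rewrite ?z0 ?rn.
- transitivity (r ^- 2 * (1 - s * sc) * x 1 0); first by field; rewrite ?z0 ?rn.
  by rewrite ss; field; rewrite ?z0 ?rn.
- transitivity (r ^- 2 * (1 - s * sc) * x 0 0); first by field; rewrite ?z0 ?rn.
  by rewrite ss; field; rewrite ?z0 ?rn.
- transitivity (r ^- 2 * (1 - s * sc) * x 1 0); first by field; rewrite ?z0 ?rn.
  by rewrite ss; field; rewrite ?z0 ?rn.
Qed.

Lemma inv_transferKV k (x : 'cV[C]_2) : transfer a z k *m (inv_transfer k *m x) = x.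
Proof.
have : inv_transfer k *m transfer a z k = 1%:M.
  apply/matrixP => i j.
  have /(congr1 (fun v : 'cV[C]_2 => v i 0)) := inv_transferK k (delta_mx j 0).
  by rewrite mulmxA -colE !mxE eqxx andbT.
by move=> /mulmx1C h; rewrite mulmxA h mul1mx.
Qed.

Lemma transfer_uniq_down k0 w w' : (forall k, k <= k0 -> transfer_step a z k w) ->
  (forall k, k <= k0 -> transfer_step a z k w') -> w k0 = w' k0 ->
  forall k, k <= k0 -> w k = w' k.
Proof.
move=> h h' e k kk0.
have {kk0} -> : k = k0 - (absz (k - k0)%R)%:Z by lia.
elim: (absz _) => [|n IH]; first by rewrite subr0.
rewrite (_ : k0 - n.+1%:Z = k0 - n%:Z - 1); last by lia.
have kn : k0 - n%:Z <= k0 by lia.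
rewrite -(inv_transferK (k0 - n%:Z) (w _)) -(inv_transferK (k0 - n%:Z) (w' _)).
have := h _ kn; have := h' _ kn; rewrite /transfer_step => <- <-.
by rewrite IH.
Qed.

Lemma transfer_uniq k0 w w' : (forall k, transfer_step a z k w) ->
  (forall k, transfer_step a z k w') ->
  w k0 = w' k0 -> w = w'.
Proof.
move=> h h' e; apply/funext => k.
have [kk|kk] := leP k0 k; first by apply: (@transfer_uniq_up a z k0).
by apply: (@transfer_uniq_down k0) => //; exact: ltW.
Qed.

Fixpoint fwd (k0 : int) (x : 'cV[C]_2) n :=
  if n is n'.+1 then transfer a z (k0 + n%:Z) *m fwd k0 x n' else x.
Fixpoint bwd (k0 : int) (x : 'cV[C]_2) n :=
  if n is n'.+1 then inv_transfer (k0 - n'%:Z) *m bwd k0 x n' else x.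

Lemma transfer_exists k0 x : exists w, (forall k, transfer_step a z k w) /\ w k0 = x.
Proof.
exists (fun k => if k0 <= k then fwd k0 x (absz (k - k0)%R) else bwd k0 x (absz (k
  - k0)%R)).
split; last by rewrite lexx subrr.
move=> k; rewrite /transfer_step; case: (ltrgtP k k0) => kk0.
- rewrite ifF; last by lia.
  rewrite (_ : absz (k - 1 - k0)%R = (absz (k - k0)%R).+1); last by lia.
  rewrite /= (_ : k0 - (absz (k - k0)%R)%:Z = k); last by lia.
  by rewrite inv_transferKV.
- rewrite ifT; last by lia.
  rewrite (_ : absz (k - k0)%R = (absz (k - 1 - k0)%R).+1); last by lia.
  rewrite /=.
  rewrite (_ : k0 + (absz (k - 1 - k0)%R).+1%:Z = k)//; lia.
- rewrite kk0 subrr ifF; last by lia.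
  by rewrite (_ : absz (k0 - 1 - k0)%R = 1%N) /= ?subr0 ?inv_transferKV//; lia.
Qed.

Lemma transfer_solP k0 x : (forall k, transfer_step a z k (transfer_sol a z k0 x)) /\
  transfer_sol a z k0 x k0 = x.
Proof.
rewrite /transfer_sol; case: xgetP => [w -> [h1 h2]|]; first by split.
by have [w [h1 h2]] := transfer_exists k0 x; move=> /(_ w) []; split.
Qed.

Lemma wronskian k0 k w w' : (forall k, transfer_step a z k w) ->
  (forall k, transfer_step a z k w') ->
  parity_sign R k * (w k 0 0 * w' k 1 0 - w' k 0 0 * w k 1 0) =
  parity_sign R k0 * (w k0 0 0 * w' k0 1 0 - w' k0 0 0 * w k0 1 0).
Proof.
move=> h h'.
have step j : parity_sign R (j + 1) * (w (j + 1) 0 0 * w' (j + 1) 1 0 - w' (j + 1)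
  0 0 * w (j + 1) 1 0)
   = parity_sign R j * (w j 0 0 * w' j 1 0 - w' j 0 0 * w j 1 0).
  rewrite (transfer_step_det (h _) (h' _)) addrK /parity_sign oddzD.
  by case: (oddz j); rewrite /= ?mulN1r ?mul1r ?opprK.
have up j n : parity_sign R (j + n%:Z) * (w (j + n%:Z) 0 0 * w' (j + n%:Z) 1 0 - w'
  (j + n%:Z) 0 0 * w (j + n%:Z) 1 0)
   = parity_sign R j * (w j 0 0 * w' j 1 0 - w' j 0 0 * w j 1 0).
  elim: n => [|n IH]; first by rewrite addr0.
  have -> : j + n.+1%:Z = j + n%:Z + 1 by lia.
  by rewrite step IH.
have [kk|kk] := leP k0 k.
  have -> : k = k0 + (absz (k - k0)%R)%:Z by lia.
  exact: up.
symmetry; have -> : k0 = k + (absz (k - k0)%R)%:Z by lia.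
exact: up.
Qed.

Lemma transfer_step_lin k w w' (c c' : C) : transfer_step a z k w ->
  transfer_step a z k w' ->
  transfer_step a z k (fun j => c *: w j + c' *: w' j).
Proof. by rewrite /transfer_step => -> ->; rewrite mulmxDr -!scalemxAr. Qed.

End Transfer.

(** * Square-summable solutions *)

Section Weyl.
Variable R : realType.
Local Notation C := R[i].
Implicit Types (w p q : int -> 'cV[C]_2) (c : C) (k : int) (D : set int).

Definition update (a : int -> C) k1 c : int -> C := fun k => if k == k1 then c else a k.

Lemma updateE a k1 c : update a k1 c k1 = c. Proof. by rewrite /update eqxx. Qed.
Lemma update_neq a k1 c k : k != k1 -> update a k1 c k = a k.
Proof. by rewrite /update => /negbTE ->. Qed.

Lemma sqs_block_op b a f : (forall k, `|a k| <= 1) -> square_summable f ->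
  square_summable (block_op b a f :> (int -> C)).
Proof. by move=> a1 [x fx]; exists x; exact: norm2_le_block_op. Qed.

Lemma green_sqs (u1 v1 u2 v2 : int -> C) k' : l2on (Zle k') u1 -> l2on (Zge k') u2 ->
  square_summable (green u1 v1 u2 v2 k').
Proof.
move=> /(l2on_Zle (k' - 1)) /l2onE s1 /(l2on_Zge (k' + 1)) /l2onE s2.
pose f k := v2 k' * cut (Zle (k' - 1)) u1 k + v1 k' * cut (Zge (k' + 1)) u2 k.
apply: (@sqs_update _ f _ k'); last by apply: sqsD; exact: sqsZ.
move=> k kk'; rewrite /f /green /upper /cut mem_Zge mem_Zle (negbTE kk') orbF.
case: ltP => h.
  rewrite (_ : k <= k' - 1); last by lia.
  rewrite (_ : k' + 1 <= k = false); last by lia.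
  by rewrite mulr0 addr0 mulrC.
rewrite (_ : k <= k' - 1 = false); last by lia.
rewrite (_ : k' + 1 <= k); last by lia.
by rewrite mulr0 add0r mulrC.
Qed.

Lemma green_resolvent D (b : int -> C) z c k' u1 v1 u2 v2 :
  (forall k, `|b k| <= 1) -> reducing D b -> `|z| != 1 -> z != 0 ->
  (forall k, k <= k' -> block_eqs b z k u1 v1) ->
  (forall k, k' < k -> block_eqs b z k u2 v2) ->
  c * z * (parity_sign R k' * (u1 k' * v2 k' - u2 k' * v1 k')) = 1 ->
  l2on (Zle k') u1 -> l2on (Zge k') u2 -> vanishes_off D (green u1 v1 u2 v2 k') ->
  resolvent D (CMV b) z (delta k') = (fun k => c * green u1 v1 u2 v2 k' k).
Proof.
move=> b1 rD z1 z0 s1 s2 cN l1 l2 sD.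
rewrite -(CMV_green z0 s1 s2 cN).
apply: resolvent_uniq; first exact: CMV_in_resolvent.
apply/l2P; split; last exact/sqsZ/green_sqs.
by move=> k /sD ->; rewrite mulr0.
Qed.

Variables (a : int -> C) (z : C).
Hypothesis ha : forall k, `|a k| < 1.
Hypothesis z0 : z != 0.
Hypothesis z1 : `|z| != 1.

Let ha' k : `|a k| <= 1. Proof. exact: ltW. Qed.

Lemma update_le1 k1 c : `|c| = 1 -> forall k, `|update a k1 c k| <= 1.
Proof. by move=> c1 k; rewrite /update; case: ifP => // _; rewrite c1. Qed.

Definition transfer_solution w := forall k, transfer_step a z k w.

Lemma transfer_solution_block_eqs w k : transfer_solution w ->
  block_eqs a z k (top w) (bot w).
Proof. by move=> /(_ k) /(transfer_step_block_eqs ha z0). Qed.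

Lemma l2vecE D w : l2vec D w <-> l2on D (top w) /\ l2on D (bot w).
Proof. by []. Qed.

Lemma l2vec_Zge k1 k2 w : l2vec (Zge k1) w -> l2vec (Zge k2) w.
Proof. by case=> h1 h2; split; [exact: l2on_Zge h1|exact: l2on_Zge h2]. Qed.

Lemma l2vec_Zle k1 k2 w : l2vec (Zle k1) w -> l2vec (Zle k2) w.
Proof. by case=> h1 h2; split; [exact: l2on_Zle h1|exact: l2on_Zle h2]. Qed.

Lemma l2vec_lin D w w' c c' : l2vec D w -> l2vec D w' ->
  l2vec D (fun k => c *: w k + c' *: w' k).
Proof.
move=> [h1 h2] [h1' h2']; split.
  apply: (@eq_l2on _ _ (fun k => c * w k 0 0 + c' * w' k 0 0)).
    by move=> k _; rewrite !mxE.
  by apply: l2onD; exact: l2onZ.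
apply: (@eq_l2on _ _ (fun k => c * w k 1 0 + c' * w' k 1 0)).
  by move=> k _; rewrite !mxE.
by apply: l2onD; exact: l2onZ.
Qed.

Lemma transfer_solution_eq0 k1 w : transfer_solution w -> w k1 = 0 -> forall k, w k = 0.
Proof.
move=> sw wk k.
have s0 : transfer_solution (fun=> 0) by move=> j; rewrite /transfer_step mulmx0.
by rewrite (transfer_uniq ha z0 sw s0 wk).
Qed.

(** Cutting the block of index [0] leaves a unitary operator on the whole
    lattice. Its resolvent applied to [delta (-1) + delta 0] solves the block
    equations of every index but [0], hence the recursion on either side of
    the cut, and is square-summable. At the cut the source makes the two
    boundary conditions inhomogeneous, so neither half is zero. *)
Lemma decaying_solutions : exists w w',
  [/\ transfer_solution w, w 0 != 0 & l2vec (Zge 0) w] /\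
  [/\ transfer_solution w', w' (-1) != 0 & l2vec (Zle (-1)) w'].
Proof.
pose b := update a 0 1.
have n1 : `|1 : C| = 1 by rewrite normr1.
have b1 : forall k, `|b k| <= 1 := update_le1 0 n1.
have rT : reducing setT b by move=> k; right.
pose f : int -> C := fun k => delta (-1) k + delta 0 k.
have sf : square_summable f by apply: sqsD; exact: sqs_delta.
have lf : l2 setT f by apply/l2P; split => // k [].
have [res _ _] := resolventP (CMV_in_resolvent b1 rT z1).
have [/l2P[_]] := res f lf.
move: (resolvent _ _ _ _) => phi sphi phiE.
pose psi := fun k => z^-1 * Wop b phi k.
have spsi : square_summable psi by apply: sqsZ; exact: sqs_block_op.
have hW : Wop b phi = fun k => z * psi k by apply/funext => k; rewrite /psi mulVKf.
have hV : Vop b psi = fun k => phi k + z^-1 * f k.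
  apply/funext => k; rewrite /psi /Vop block_opZ.
  have /(congr1 (fun F => F k)) := phiE; rewrite /addcI /CMV => <-.
  by rewrite /Vop; field.
have bW k : oddz k -> block_eq b k phi (fun j => z * psi j).
  by move=> ko; rewrite -hW; exact: block_op_block_eq.
have bV k : ~~ oddz k -> block_eq b k psi (fun j => phi j + z^-1 * f j).
  by move=> /negbTE ko; rewrite -hV; exact: block_op_block_eq.
have bs k : k != 0 -> block_eqs a z k phi psi.
  move=> k0; rewrite /block_eqs -/(block_eq a k);
    have e : b k = a k by rewrite /b update_neq.
  case: ifPn => ko; first by have := bW k ko; rewrite /block_eq e.
  have := bV k ko; rewrite /block_eq e /f /delta.
  rewrite (_ : k == 0 = false); last exact: negbTE.
  rewrite (_ : k - 1 == -1 = false); last by lia.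
  have kodd : k != -1 by apply/eqP => kk; move: ko; rewrite kk.
  rewrite (_ : k == -1 = false); last exact: negbTE.
  have kodd' : k != 1 by apply/eqP => kk; move: ko; rewrite kk.
  rewrite (_ : k - 1 == 0 = false); last by lia.
  by rewrite !addr0 !mulr0 !addr0.
pose w k := cv2 (phi k) (psi k).
have tw : top w = phi by apply/funext => k; rewrite /top cv2E0.
have bw : bot w = psi by apply/funext => k; rewrite /bot cv2E1.
have rw k : k != 0 -> transfer_step a z k w.
  by move=> k0; apply/(transfer_step_block_eqs ha z0); rewrite tw bw; exact: bs.
have lw D : l2vec D w by apply/l2vecE; rewrite tw bw; split; exact: sqs_l2on.
have [e1 e2] : - psi (-1) = phi (-1) + z^-1 /\ psi 0 = phi 0 + z^-1.
  have := bV 0 isT; rewrite /block_eq /b updateE rho_eq0// conjC1 !mul0r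
    !addr0 add0r mulN1r mul1r /f /delta.
  by rewrite /= addr0 !add0r mulr1.
have zi : z^-1 != 0 by rewrite invr_eq0.
have [s1 i1] := transfer_solP ha z0 0 (w 0).
have [s2 i2] := transfer_solP ha z0 (-1) (w (-1)).
exists (transfer_sol a z 0 (w 0)), (transfer_sol a z (-1) (w (-1))); split; split => //.
- rewrite i1; apply/eqP => h.
  move: e2; have -> : psi 0 = 0 by rewrite -bw /bot h mxE.
  have -> : phi 0 = 0 by rewrite -tw /top h mxE.
  by rewrite add0r => /esym/eqP; rewrite (negbTE zi).
- have E k : Zge 0 k -> w k = transfer_sol a z 0 (w 0) k.
    move=> k0; apply: (@transfer_uniq_up _ a z 0 w _ _ (fun j _ => s1 j) (esym i1)
      k k0).
    by move=> j j0; apply: rw; rewrite gt_eqF.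
  have [h1 h2] := lw (Zge 0).
  by split; [apply: eq_l2on h1|apply: eq_l2on h2] => k /E ->.
- rewrite i2; apply/eqP => h.
  move: e1; have -> : psi (-1) = 0 by rewrite -bw /bot h mxE.
  have -> : phi (-1) = 0 by rewrite -tw /top h mxE.
  by rewrite oppr0 add0r => /esym/eqP; rewrite (negbTE zi).
- have E k : Zle (-1) k -> w k = transfer_sol a z (-1) (w (-1)) k.
    move=> k0; apply: (@transfer_uniq_down _ a z ha z0 (-1) w _ _ (fun j _ => s2 j)
      (esym i2) k k0).
    by move=> j j0; apply: rw; lia.
  have [h1 h2] := lw (Zle (-1)).
  by split; [apply: eq_l2on h1|apply: eq_l2on h2] => k /E ->.
Qed.

Definition decays D :=
  exists w, [/\ transfer_solution w, (forall k, w k != 0) & l2vec D w].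

Lemma decays_right k0 : decays (Zge k0).
Proof.
have [w [_ [[sw w0 lw] _]]] := decaying_solutions; exists w; split => //.
  by move=> k; apply: contra w0 => /eqP /(transfer_solution_eq0 sw) ->.
exact: l2vec_Zge lw.
Qed.

Lemma decays_left k0 : decays (Zle k0).
Proof.
have [_ [w [_ [sw w0 lw]]]] := decaying_solutions; exists w; split => //.
  by move=> k; apply: contra w0 => /eqP /(transfer_solution_eq0 sw) ->.
exact: l2vec_Zle lw.
Qed.

Lemma two_sided_l2_eq0 k0 w : transfer_solution w -> l2vec (Zge k0) w ->
  l2vec (Zle k0) w ->
  forall k, w k = 0.
Proof.
move=> sw [h1 _] [h2 _].
have su : square_summable (top w).
  have := l2onU h1 h2.
  have -> : Zge k0 `|` Zle k0 = setT.
    by apply/seteqP; split => // k _; case: (lerP k0 k) => h; [left|right => /=;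
      exact: ltW].
  by move/l2onE; rewrite cut_id // => k [].
have H := block_eqs_l2_eq0 ha' z1 z0 (fun k => transfer_solution_block_eqs k sw) su.
by move=> k; have [e1 e2] := H k; apply: cv2P; rewrite mxE.
Qed.

(** The values at either end of the block [k1] that satisfy the boundary
    condition of a cut at [k1] for some unimodular coefficient. *)
Definition unimodular_ratio_at k1 (x : 'cV[C]_2) :=
  if oddz k1 then `|x 0 0| = `|z * x 1 0| else `|x 0 0| = `|x 1 0|.

(** The block is unitary, so it preserves the sum of the squared moduli over
    its two sites; hence the moduli agree at one end if and only if they agree
    at the other. *)
Lemma unimodular_ratio_atB k1 w : transfer_solution w ->
  unimodular_ratio_at k1 (w k1) <-> unimodular_ratio_at k1 (w (k1 - 1)).
Proof.
move=> /transfer_solution_block_eqs -/(_ k1); rewrite /block_eqs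
  /unimodular_ratio_at /top /bot.
have E (x y : C) : (`|x| = `|y|) <-> (x^* * x = y^* * y).
  rewrite -!normCKC; split => [->//|/eqP].
  by rewrite eqrXn2 ?normr_ge0// => /eqP.
case: ifP => _ h; have := block_eq_dot (ha' k1) h h => /= {}h; rewrite !E.
  by split => e; [move: h; rewrite e => /addIr ->|move: h; rewrite e => /addrI ->].
by split => e; [move: h; rewrite e => /addIr ->|move: h; rewrite e => /addrI ->].
Qed.

Lemma unimodular_ratio (x y : C) : `|x| = `|y| -> exists2 c, `|c| = 1 & c * x = y.
Proof.
move=> xy; have [x0|x0] := eqVneq x 0.
  exists 1; first exact: normr1.
  by move/eqP: xy; rewrite x0 normr0 eq_sym normr_eq0 mulr0 => /eqP ->.
exists (y / x); last by rewrite divfK.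
by rewrite normrM normfV -xy divff// normr_eq0.
Qed.

(** Choosing the coefficient of the cut to fit the solution makes the
    truncated solution an eigenvector of a unitary operator. *)
Lemma unimodular_right0 k1 w : transfer_solution w ->
  unimodular_ratio_at k1 (w k1) -> l2vec (Zge k1) w -> w k1 = 0.
Proof.
move=> sw um [h1 _].
have [c c1 bc] : exists2 c, `|c| = 1 & bc_right (fun=> c) z k1 (top w) (bot w).
  have [c c1 h] : exists2 c, `|c| = 1 & if oddz k1 then c * w k1 0 0 = z * w k1 1 0
                                        else c * w k1 1 0 = w k1 0 0.
    by move: um; rewrite /unimodular_ratio_at; case: ifP => _ um;
      exact: unimodular_ratio.
  by exists c^*; rewrite ?norm_conjC// /bc_right conjCK.
have bE : `|update a k1 c k1| = 1 by rewrite updateE.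
have bc' : bc_right (update a k1 c) z k1 (top w) (bot w)
  by move: bc; rewrite /bc_right updateE.
have S := block_eqs_cut_right bE (fun k => @update_neq a k1 c k)
  (fun k _ => transfer_solution_block_eqs k sw) bc'.
have [] := block_eqs_l2_eq0 (update_le1 k1 c1) z1 z0 S _ k1; first exact/l2onE.
rewrite /cut mem_Zge lexx => e1 e2.
by apply: cv2P; rewrite mxE.
Qed.

Lemma unimodular_left0 k1 w : transfer_solution w ->
  unimodular_ratio_at k1 (w (k1 - 1)) -> l2vec (Zle (k1 - 1)) w ->
  w (k1 - 1) = 0.
Proof.
move=> sw um [h1 _].
have [c c1 bc] : exists2 c, `|c| = 1 & bc_left (fun=> c) z k1 (top w) (bot w).
  have [c c1 h] : exists2 c, `|c| = 1 &
      if oddz k1 then c * w (k1 - 1) 0 0 = z * w (k1 - 1) 1 0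
      else c * w (k1 - 1) 1 0 = w (k1 - 1) 0 0.
    by move: um; rewrite /unimodular_ratio_at; case: ifP => _ um;
      exact: unimodular_ratio.
  by exists (- c); rewrite ?normrN// /bc_left opprK.
have bE : `|update a k1 c k1| = 1 by rewrite updateE.
have bc' : bc_left (update a k1 c) z k1 (top w) (bot w)
  by move: bc; rewrite /bc_left updateE.
have S := block_eqs_cut_left bE (fun k => @update_neq a k1 c k)
  (fun k _ => transfer_solution_block_eqs k sw) bc'.
have [] := block_eqs_l2_eq0 (update_le1 k1 c1) z1 z0 S _ (k1 - 1); first exact/l2onE.
rewrite /cut mem_Zle lexx => e1 e2.
by apply: cv2P; rewrite mxE.
Qed.

(** A half-lattice boundary condition at [k1] rules out decay at both ends of
    the lattice, since it is equivalent to one for the complementary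
    half-lattice, with a different unimodular coefficient. *)
Lemma unimodular_not_l2 k1 w j : transfer_solution w ->
  unimodular_ratio_at k1 (w k1) -> w k1 != 0 ->
  ~ l2vec (Zge j) w /\ ~ l2vec (Zle j) w.
Proof.
move=> sw um w0; split => h; move/eqP: w0; apply.
  by apply: unimodular_right0 => //; exact: l2vec_Zge h.
apply: (@transfer_solution_eq0 (k1 - 1)) => //; apply: unimodular_left0 => //.
  exact/unimodular_ratio_atB.
exact: l2vec_Zle h.
Qed.

(** A decaying solution is a combination of [q] and [p] with a nonzero
    coefficient at [q], since [p] does not decay; two admissible values of [M]
    would make [p] decay. *)
Lemma weyl_unique D k0 p q : transfer_solution p -> transfer_solution q ->
  p k0 0 0 * q k0 1 0 - q k0 0 0 * p k0 1 0 != 0 ->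
  decays D -> ~ l2vec D p ->
  exists! M : C, l2vec D (fun k => q k + M *: p k).
Proof.
move=> sp sq wr [w [sw w0 lw]] np.
(* Cramer's rule at k0: w = c1 q + c2 p *)
set d := p k0 0 0 * _ - _ in wr.
pose c1 := (p k0 0 0 * w k0 1 0 - w k0 0 0 * p k0 1 0) / d.
pose c2 := (w k0 0 0 * q k0 1 0 - q k0 0 0 * w k0 1 0) / d.
have dn : p k0 0 0 * q k0 1 0 - q k0 0 0 * p k0 1 0 != 0 by [].
have wE : w = fun k => c1 *: q k + c2 *: p k.
  apply: (@transfer_uniq _ a z ha z0 k0) => //.
    by move=> k; apply: transfer_step_lin.
  by apply: cv2P; rewrite !mxE /c1 /c2 /d; field.
have c1n : c1 != 0.
  apply/eqP => c10; apply: np.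
  have c2n : c2 != 0.
    by apply: contra (w0 k0) => /eqP c20; rewrite wE c10 c20 !scale0r addr0.
  have -> : p = fun k => c2^-1 *: w k + 0 *: w k.
    by apply/funext => k; rewrite wE c10 !scale0r add0r addr0 scalerA mulVf// scale1r.
  exact: l2vec_lin.
exists (c2 / c1); split.
  have -> : (fun k => q k + (c2 / c1) *: p k) = (fun k => c1^-1 *: w k + 0 *: w k).
    apply/funext => k; rewrite wE scale0r addr0 scalerDr !scalerA mulVf// scale1r.
    by rewrite [c2 / c1]mulrC.
  exact: l2vec_lin.
move=> M lM; apply/eqP/negPn/negP => ne; apply: np.
have dM : c2 / c1 - M != 0 by rewrite subr_eq0.
have dM' : c2 + - M * c1 != 0.
  by rewrite mulNr subr_eq0; apply: contra ne => /eqP ->; rewrite mulfK.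
have -> : p = fun k => (c2 / c1 - M)^-1 *: (c1^-1 *: w k + 0 *: w k) +
                       (- (c2 / c1 - M)^-1) *: (q k + M *: p k).
  apply/funext => k; rewrite wE; apply: cv2P; rewrite !mxE; field; rewrite ?c1n//.
by apply: l2vec_lin => //; exact: l2vec_lin.
Qed.

End Weyl.

(** * The boundary phases *)

Section Gam.
Variable R : realType.
Local Notation C := R[i].
Variable t : R.
Local Notation g := (gam t).

Lemma conjE (x y : R) : (Complex x y)^* = Complex x (- y) :> C.
Proof. by []. Qed.

Lemma gam_conj : g * g^* = 1.
Proof.
rewrite /gam /expi conjE; apply/eqP; rewrite eq_complex /=; apply/andP; split;
  apply/eqP.
  by rewrite mulrN opprK -!expr2 cos2Dsin2.
by rewrite mulrC; ring.
Qed.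

Lemma expi_gam : expi t * g = g^*.
Proof.
rewrite /gam /expi conjE sinN cosN opprK.
have -> : cos t = cos (t / 2) ^+ 2 - sin (t / 2) ^+ 2.
  by rewrite {1}(splitr t) cosD -!expr2.
have -> : sin t = 2 * (sin (t / 2) * cos (t / 2)).
  by rewrite {1}(splitr t) sinD; ring.
have := cos2Dsin2 (t / 2); move: (cos _) (sin _) => c s cs.
apply/eqP; rewrite eq_complex /=; apply/andP; split; apply/eqP.
  transitivity (c * (c ^+ 2 + s ^+ 2)); first by ring.
  by rewrite cs mulr1.
transitivity (s * (c ^+ 2 + s ^+ 2)); first by ring.
by rewrite cs mulr1.
Qed.

Lemma gam_neq0 : g != 0.
Proof.
apply/eqP => h; have := gam_conj.
by rewrite h mul0r => /esym/eqP; rewrite oner_eq0.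
Qed.

Lemma expi_conj_gam : (expi t)^* * g^* = g.
Proof. by rewrite -[RHS]conjCK -[in RHS]expi_gam rmorphM. Qed.

Lemma expiE : expi t = g^* * g^*.
Proof. by rewrite -[in X in X * _]expi_gam -mulrA gam_conj mulr1. Qed.

Lemma norm_gam : `|g| = 1.
Proof.
apply/eqP; rewrite -(@pexpr_eq1 _ _ 2)//; first by rewrite normCK gam_conj.
Qed.

Lemma norm_expi : `|expi t| = 1 :> C.
Proof. by rewrite expiE normrM !norm_conjC norm_gam mulr1. Qed.

End Gam.

Lemma reducing_Zge (R : realType) (b : int -> R[i]) k1 : `|b k1| = 1 ->
  reducing (Zge k1) b.
Proof.
move=> b1 k; have [->|kk] := eqVneq k k1; [by left|right].
by rewrite /Zge /=; split; lia.
Qed.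

Lemma reducing_Zle (R : realType) (b : int -> R[i]) k1 : `|b (k1 + 1)| = 1 ->
  reducing (Zle k1) b.
Proof.
move=> b1 k; have [->|kk] := eqVneq k (k1 + 1); [by left|right].
by rewrite /Zle /=; split; lia.
Qed.

(** * The Weyl-Titchmarsh functions and the resolvents *)

Section Green.
Variable R : realType.
Local Notation C := R[i].
Variables (alpha : int -> C) (t : R) (k0 : int).
Hypothesis ha : forall k, `|alpha k| < 1.
Local Notation g := (gam t).
Local Notation p z := (pr_plus alpha t k0 z).
Local Notation q z := (qs_plus alpha t k0 z).
Local Notation pm z := (pr_minus alpha t k0 z).
Local Notation qm z := (qs_minus alpha t k0 z).

Section Fixz.
Variable z : C.
Hypothesis z0 : z != 0.
Hypothesis z1 : `|z| != 1.

Lemma p_solution : transfer_solution alpha z (p z).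
Proof. exact: (transfer_solP ha z0 k0 _).1. Qed.

Lemma q_solution : transfer_solution alpha z (q z).
Proof. exact: (transfer_solP ha z0 k0 _).1. Qed.

Lemma pm_solution : transfer_solution alpha z (pm z).
Proof. exact: (transfer_solP ha z0 k0 _).1. Qed.

Lemma qm_solution : transfer_solution alpha z (qm z).
Proof. exact: (transfer_solP ha z0 k0 _).1. Qed.

Lemma p_init : p z k0 = if oddz k0 then cv2 (z * g^*) g else cv2 g g^*.
Proof. exact: (transfer_solP ha z0 k0 _).2. Qed.

Lemma q_init : q z k0 = if oddz k0 then cv2 (z * g^*) (- g) else cv2 (- g) g^*.
Proof. exact: (transfer_solP ha z0 k0 _).2. Qed.

Lemma pm_init : pm z k0 = if oddz k0 then cv2 g^* (- g) else cv2 (- (z * g)) g^*.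
Proof. exact: (transfer_solP ha z0 k0 _).2. Qed.

Lemma qm_init : qm z k0 = if oddz k0 then cv2 g^* g else cv2 (z * g) g^*.
Proof. exact: (transfer_solP ha z0 k0 _).2. Qed.

Lemma pq_wronskian : p z k0 0 0 * q z k0 1 0 - q z k0 0 0 * p z k0 1 0 =
  parity_sign R k0 * (2 * z ^+ oddz k0).
Proof.
rewrite p_init q_init /parity_sign; case: (oddz k0); rewrite !cvE ?expr1 ?expr0.
  by transitivity (- 2 * z * (g * g^*)); [ring|rewrite gam_conj; ring].
by transitivity (2 * (g * g^*)); [ring|rewrite gam_conj; ring].
Qed.

Lemma pqm_wronskian : qm z k0 0 0 * pm z k0 1 0 - pm z k0 0 0 * qm z k0 1 0 =
  parity_sign R k0 * (2 * z ^+ oddz (k0 + 1)).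
Proof.
rewrite pm_init qm_init /parity_sign oddzD; case: (oddz k0); rewrite !cvE ?expr1 ?expr0.
  by transitivity (- 2 * (g * g^*)); [ring|rewrite gam_conj; ring].
by transitivity (2 * z * (g * g^*)); [ring|rewrite gam_conj; ring].
Qed.

Lemma parity_sign_sq k : parity_sign R k * parity_sign R k = 1.
Proof. by rewrite /parity_sign; case: ifP => _; rewrite ?mulrNN mulr1. Qed.

Let two0 : (2 : C) != 0. Proof. by rewrite pnatr_eq0. Qed.

Let ze0 b : z ^+ (b : bool) != 0. Proof. exact: expf_neq0. Qed.

Lemma parity_sign_neq0 k : parity_sign R k != 0.
Proof. by rewrite /parity_sign; case: ifP => _; rewrite ?oppr_eq0 oner_eq0. Qed.

Lemma p_unimodular : unimodular_ratio_at z k0 (p z k0).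
Proof.
by rewrite /unimodular_ratio_at p_init; case: (oddz k0);
  rewrite !cvE /= ?normrM ?norm_conjC ?norm_gam.
Qed.

Lemma pm_unimodular : unimodular_ratio_at z (k0 + 1) (pm z k0).
Proof.
by rewrite /unimodular_ratio_at pm_init oddzD; case: (oddz k0);
  rewrite !cvE /= ?normrN ?normrM ?norm_conjC ?norm_gam ?mulr1.
Qed.

Lemma p_not_l2 j : ~ l2vec (Zge j) (p z) /\ ~ l2vec (Zle j) (p z).
Proof.
apply: (unimodular_not_l2 ha z0 z1 (k1 := k0) j p_solution p_unimodular).
rewrite p_init; apply/eqP => /colP /(_ 1); rewrite mxE; case: ifP => _;
  rewrite mxE => /eqP.
  by rewrite (negbTE (gam_neq0 t)).
by rewrite conjC_eq0 (negbTE (gam_neq0 t)).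
Qed.

Lemma pm_not_l2 j : ~ l2vec (Zle j) (pm z).
Proof.
(* p_minus satisfies a condition at the left end of the block k0 + 1 *)
have um : unimodular_ratio_at z (k0 + 1) (pm z (k0 + 1)).
  by apply/(unimodular_ratio_atB ha z0 _ pm_solution); rewrite addrK;
    exact: pm_unimodular.
have [] := unimodular_not_l2 ha z0 z1 (k1 := k0 + 1) j pm_solution um; last by [].
apply/eqP => /(transfer_solution_eq0 ha z0 pm_solution) /(_ k0).
rewrite pm_init => /colP /(_ 1); rewrite mxE; case: ifP => _; rewrite mxE => /eqP.
  by rewrite oppr_eq0 (negbTE (gam_neq0 t)).
by rewrite conjC_eq0 (negbTE (gam_neq0 t)).
Qed.

Lemma ex_M_plus : exists! M : C, l2vec (Zge k0) (weyl_comb alpha t k0 z M).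
Proof.
apply: (weyl_unique ha z0 p_solution q_solution (k0 := k0)).
- by rewrite pq_wronskian !mulf_neq0// parity_sign_neq0.
- exact: decays_right.
- by have [] := p_not_l2 k0.
Qed.

Lemma ex_M_minus : exists! M : C, l2vec (Zle k0) (weyl_comb alpha t k0 z M).
Proof.
apply: (weyl_unique ha z0 p_solution q_solution (k0 := k0)).
- by rewrite pq_wronskian !mulf_neq0// parity_sign_neq0.
- exact: decays_left.
- by have [] := p_not_l2 k0.
Qed.

Lemma ex_m_minus : exists! M : C, l2vec (Zle k0) (fun k => qm z k + M *: pm z k).
Proof.
apply: (weyl_unique ha z0 pm_solution qm_solution (k0 := k0)).
- by rewrite -oppr_eq0 opprB pqm_wronskian !mulf_neq0// parity_sign_neq0.
- exact: decays_left.
- exact: pm_not_l2.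
Qed.

Lemma M_plusP : l2vec (Zge k0) (weyl_comb alpha t k0 z (M_plus alpha t k0 z)).
Proof.
rewrite /M_plus; case: xgetP => [M _ []//|h].
by have [M hM] := ex_M_plus; case: (h M).
Qed.

Lemma M_plus_uniq M : l2vec (Zge k0) (weyl_comb alpha t k0 z M) ->
  M = M_plus alpha t k0 z.
Proof.
by have [N [_ hN]] := ex_M_plus; move=> /hN <-; apply: hN; exact: M_plusP.
Qed.

Lemma M_minusP : l2vec (Zle k0) (weyl_comb alpha t k0 z (M_minus alpha t k0 z)).
Proof.
rewrite /M_minus; case: xgetP => [M _ []//|h].
by have [M hM] := ex_M_minus; case: (h M).
Qed.

Lemma M_minus_uniq M : l2vec (Zle k0) (weyl_comb alpha t k0 z M) ->
  M = M_minus alpha t k0 z.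
Proof.
by have [N [_ hN]] := ex_M_minus; move=> /hN <-; apply: hN; exact: M_minusP.
Qed.

Lemma weyl_comb_solution M : transfer_solution alpha z (weyl_comb alpha t k0 z M).
Proof.
move=> k; have := transfer_step_lin 1 M (q_solution k) (p_solution k).
by rewrite /weyl_comb /transfer_step !scale1r.
Qed.

(** Otherwise the same solution would decay at both ends of the lattice. *)
Lemma M_neq : M_plus alpha t k0 z != M_minus alpha t k0 z.
Proof.
apply/eqP => h; have := M_plusP; rewrite h => h1.
have w0 := two_sided_l2_eq0 ha z0 z1 (weyl_comb_solution _) h1 M_minusP k0.
have /eqP : parity_sign R k0 * (2 * z ^+ oddz k0) = 0.
  rewrite -pq_wronskian.
  have /colP e := w0; have := e 0; have := e 1.
  rewrite !mxE => e1 e0.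
  have -> : q z k0 1 0 = - (M_minus alpha t k0 z * p z k0 1 0) by apply/eqP;
    rewrite -addr_eq0 e1.
  have -> : q z k0 0 0 = - (M_minus alpha t k0 z * p z k0 0 0) by apply/eqP;
    rewrite -addr_eq0 e0.
  by ring.
by rewrite !mulf_eq0 (negbTE (parity_sign_neq0 _)) (negbTE two0) (negbTE (ze0 _)).
Qed.

Lemma set_alpha_le1 k1 k : `|set_alpha alpha t k1 k| <= 1.
Proof. exact: (update_le1 ha k1 (norm_expi t)). Qed.

Lemma set_alphaE k1 : set_alpha alpha t k1 k1 = expi t.
Proof. by rewrite /set_alpha eqxx. Qed.

Lemma norm_set_alpha k1 : `|set_alpha alpha t k1 k1| = 1.
Proof. by rewrite set_alphaE norm_expi. Qed.

Lemma block_eqs_set_alpha k1 k w : k != k1 -> transfer_solution alpha z w ->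
  block_eqs (set_alpha alpha t k1) z k (top w) (bot w).
Proof.
move=> kk sw; have := transfer_solution_block_eqs ha z0 k sw.
by rewrite /block_eqs /block_eq /set_alpha (negbTE kk).
Qed.

Lemma p_bc : bc_right (set_alpha alpha t k0) z k0 (top (p z)) (bot (p z)).
Proof.
rewrite /bc_right set_alphaE /top /bot p_init; case: (oddz k0); rewrite !cvE /=.
  by rewrite mulrCA expi_conj_gam.
exact: expi_conj_gam.
Qed.

Lemma pm_bc : bc_left (set_alpha alpha t (k0 + 1)) z (k0 + 1) (top (pm z)) (bot (pm z)).
Proof.
rewrite /bc_left set_alphaE /top /bot addrK pm_init oddzD; case: (oddz k0);
  rewrite !cvE /=.
  by rewrite mulrNN expi_gam.
by rewrite mulrNN mulrCA expi_gam.
Qed.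

(** The inner solution is [p], truncated to the half-lattice on which it is an
    exact solution by its boundary condition. Only the blocks beyond [k']
    matter for the outer solution, and the cut does not touch them. *)
Lemma resolvent_plus M k' : k0 <= k' -> l2vec (Zge k0) (weyl_comb alpha t k0 z M) ->
  let w := weyl_comb alpha t k0 z M in
  resolvent (Zge k0) (CMV_plus alpha t k0) z (delta k') =
  (fun k => z ^- oddz k0 / (2 * z) *
    green (cut (Zge k0) (top (p z))) (cut (Zge k0) (bot (p z)))
      (top w) (bot w) k' k).
Proof.
move=> kk lw w; have sw : transfer_solution alpha z w := weyl_comb_solution M.
have pc k : k0 <= k -> cut (Zge k0) (top (p z)) k = p z k 0 0.
  by rewrite /cut mem_Zge => ->.
have pc' k : k0 <= k -> cut (Zge k0) (bot (p z)) k = p z k 1 0.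
  by rewrite /cut mem_Zge => ->.
apply: green_resolvent => //.
- exact: set_alpha_le1.
- exact/reducing_Zge/norm_set_alpha.
- move=> k _; apply: (@block_eqs_cut_right _ alpha) => //.
  + exact: norm_set_alpha.
  + by move=> j jk; rewrite /set_alpha (negbTE jk).
  + by move=> j _; exact: transfer_solution_block_eqs p_solution.
  + exact: p_bc.
- move=> k k'k; apply: block_eqs_set_alpha => //; lia.
- rewrite pc// pc'// /top /bot (wronskian ha z0 k0 k' p_solution sw).
  have -> : p z k0 0 0 * w k0 1 0 - w k0 0 0 * p z k0 1 0 =
    p z k0 0 0 * q z k0 1 0 - q z k0 0 0 * p z k0 1 0.
    by rewrite /w /weyl_comb !mxE; ring.
  rewrite pq_wronskian; transitivity (parity_sign R k0 * parity_sign R k0);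
    last exact: parity_sign_sq.
  by field; rewrite z0 ze0.
- apply: (@l2on_Zle _ (k0 - 1)); apply: (@eq_l2on _ _ (fun=> 0));
  last exact/sqs_l2on/sqs0.
  by rewrite /Zle /= => k kk0; rewrite /cut mem_Zge ifF//; lia.
- by have [h _] := lw; exact: l2on_Zge h.
- move=> k /negP; rewrite -ltNge => kk0; rewrite /green /upper /cut
  !mem_Zge (_ : k < k'); last by lia.
  by rewrite (_ : k0 <= k = false) ?mul0r//; lia.
Qed.

Lemma resolvent_minus M k' : k' <= k0 ->
  l2vec (Zle k0) (fun k => qm z k + M *: pm z k) ->
  let w := fun k => qm z k + M *: pm z k in
  resolvent (Zle k0) (CMV_minus alpha t k0) z (delta k') =
  (fun k => z ^- oddz (k0 + 1) / (2 * z) *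
    green (top w) (bot w)
      (cut (Zle k0) (top (pm z))) (cut (Zle k0) (bot (pm z))) k' k).
Proof.
move=> kk lw w.
have sw : transfer_solution alpha z w.
  by move=> k; have := transfer_step_lin 1 M (qm_solution k) (pm_solution k);
    rewrite /w /transfer_step !scale1r.
have pc k : k <= k0 -> cut (Zle k0) (top (pm z)) k = pm z k 0 0.
  by rewrite /cut mem_Zle => ->.
have pc' k : k <= k0 -> cut (Zle k0) (bot (pm z)) k = pm z k 1 0.
  by rewrite /cut mem_Zle => ->.
apply: green_resolvent => //.
- exact: set_alpha_le1.
- exact/reducing_Zle/norm_set_alpha.
- move=> k k'k; apply: block_eqs_set_alpha => //; lia.
- move=> k _; rewrite (_ : Zle k0 = Zle (k0 + 1 - 1)); last by rewrite addrK.
  apply: (@block_eqs_cut_left _ alpha) => //.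
  + exact: norm_set_alpha.
  + by move=> j jk; rewrite /set_alpha (negbTE jk).
  + by move=> j _; exact: transfer_solution_block_eqs pm_solution.
  + exact: pm_bc.
- rewrite pc// pc'// /top /bot (wronskian ha z0 k0 k' sw pm_solution).
  have -> : w k0 0 0 * pm z k0 1 0 - pm z k0 0 0 * w k0 1 0 =
    qm z k0 0 0 * pm z k0 1 0 - pm z k0 0 0 * qm z k0 1 0.
    by rewrite /w !mxE; ring.
  rewrite pqm_wronskian; transitivity (parity_sign R k0 * parity_sign R k0);
    last exact: parity_sign_sq.
  by field; rewrite z0 ze0.
- by have [h _] := lw; exact: l2on_Zle h.
- apply: (@l2on_Zge _ (k0 + 1)); apply: (@eq_l2on _ _ (fun=> 0));
  last exact/sqs_l2on/sqs0.
  by rewrite /Zge /= => k kk0; rewrite /cut mem_Zle ifF//; lia.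
- move=> k /negP; rewrite -ltNge => kk0; rewrite /green /upper /cut
  !mem_Zle (_ : k < k' = false); last by lia.
  by rewrite (_ : k == k' = false) 1?(_ : k <= k0 = false) ?mul0r//; lia.
Qed.

Lemma resolvent_full k' :
  let wp := uv_plus alpha t k0 z in let wm := uv_minus alpha t k0 z in
  resolvent setT (CMV alpha) z (delta k') =
  (fun k => - z ^- oddz k0 / (2 * z * (M_plus alpha t k0 z - M_minus alpha t k0 z)) *
     green (top wm) (bot wm) (top wp) (bot wp) k' k).
Proof.
move=> wp wm.
have sp : transfer_solution alpha z wp by exact: weyl_comb_solution.
have sm : transfer_solution alpha z wm by exact: weyl_comb_solution.
have Mn : M_plus alpha t k0 z - M_minus alpha t k0 z != 0 by rewrite subr_eq0 M_neq.
apply: green_resolvent => //.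
- by move=> k; exact: ltW.
- by move=> k; right.
- by move=> k _; exact: transfer_solution_block_eqs sm.
- by move=> k _; exact: transfer_solution_block_eqs sp.
- rewrite /top /bot (wronskian ha z0 k0 k' sm sp).
  have -> : wm k0 0 0 * wp k0 1 0 - wp k0 0 0 * wm k0 1 0 =
     - (M_plus alpha t k0 z - M_minus alpha t k0 z) *
     (p z k0 0 0 * q z k0 1 0 - q z k0 0 0 * p z k0 1 0).
    by rewrite /wm /wp /uv_minus /uv_plus /weyl_comb !mxE; ring.
  rewrite pq_wronskian.
  transitivity (parity_sign R k0 * parity_sign R k0); last exact: parity_sign_sq.
  by field; rewrite z0 ze0 Mn.
- by have [h _] := M_minusP; exact: l2on_Zle h.
- by have [h _] := M_plusP; exact: l2on_Zge h.
- by move=> k [].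
Qed.

(** Since [(A - z) g = delta k0] for [g] the resolvent column, [(A + z) g] is
    [delta k0 + 2 z g]. *)
Lemma m_value D A (x : C) G : in_resolvent_set D A z -> D k0 ->
  resolvent D A z (delta k0) = G -> G k0 = x ->
  l2dot (delta k0) (addcI A z (resolvent D A z (delta k0))) = 1 + 2 * z * x.
Proof.
move=> res Dk0 GE <-; rewrite l2dot_delta GE.
have [/(_ _ (l2_delta R Dk0)) [_]] := resolventP res.
rewrite GE => /(congr1 (fun F => F k0)); rewrite /addcI /delta eqxx => e _ _.
transitivity (A G k0 + - z * G k0 + 2 * z * G k0); first by ring.
by rewrite e.
Qed.

(** The diagonal entry of the Green function at [k0] only involves the initial
    values. *)
Lemma m_plusE : m_plus alpha t k0 z = M_plus alpha t k0 z.
Proof.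
have E := resolvent_plus (lexx k0) M_plusP.
have res : in_resolvent_set (Zge k0) (CMV_plus alpha t k0) z.
  apply: CMV_in_resolvent => //; first exact: set_alpha_le1.
  exact/reducing_Zge/norm_set_alpha.
rewrite /m_plus (m_value res _ E (erefl _)); last exact: lexx.
rewrite /green /upper ltxx eqxx /= /cut !mem_Zge lexx /top /bot /weyl_comb !mxE.
rewrite p_init q_init; case: (oddz k0); rewrite !cvE /= ?expr1 ?expr0.
  transitivity (1 + (M_plus alpha t k0 z - 1) * (g * g^*)); first by field; rewrite z0.
  by rewrite gam_conj; ring.
transitivity (1 + (M_plus alpha t k0 z - 1) * (g * g^*)); first by field; rewrite z0.
by rewrite gam_conj; ring.
Qed.

Lemma m_minus_uniq M : l2vec (Zle k0) (fun k => qm z k + M *: pm z k) ->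
  m_minus alpha t k0 z = M.
Proof.
move=> lM; have E := resolvent_minus (lexx k0) lM.
have res : in_resolvent_set (Zle k0) (CMV_minus alpha t k0) z.
  apply: CMV_in_resolvent => //; first exact: set_alpha_le1.
  exact/reducing_Zle/norm_set_alpha.
rewrite /m_minus (m_value res _ E (erefl _)); last exact: lexx.
rewrite /green /upper ltxx eqxx /= /cut !mem_Zle lexx /top /bot !mxE.
rewrite pm_init qm_init oddzD; case: (oddz k0); rewrite !cvE ?expr1 ?expr0 /=.
  transitivity (- 1 - (- M - 1) * (g * g^*)); last by rewrite gam_conj; ring.
  by field; rewrite z0.
transitivity (- 1 - (- M - 1) * (g * g^*)); last by rewrite gam_conj; ring.
by field; rewrite z0.
Qed.

Lemma uvhat_minus_l2 : l2vec (Zle k0) (uvhat_minus alpha t k0 z).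
Proof.
have [M [lM _]] := ex_m_minus.
by rewrite /uvhat_minus (m_minus_uniq lM).
Qed.

Lemma uvhat_plusE : uvhat_plus alpha t k0 z = uv_plus alpha t k0 z.
Proof. by rewrite /uvhat_plus m_plusE. Qed.

Lemma uvhat_plus_l2 : l2vec (Zge k0) (uvhat_plus alpha t k0 z).
Proof. by rewrite uvhat_plusE; exact: M_plusP. Qed.

Lemma entry_plus k k' : k0 <= k -> k0 <= k' ->
  entry (resolvent (Zge k0) (CMV_plus alpha t k0) z) k k' = G_plus_uv alpha t k0 k k' z.
Proof.
move=> h h'; rewrite entryE (resolvent_plus h' M_plusP) /G_plus_uv; congr (_ * _).
rewrite /uhat_plus /vhat_plus uvhat_plusE /green /cut !mem_Zge h h'.
by case: ifP.
Qed.

Lemma entry_minus k k' : k <= k0 -> k' <= k0 ->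
  entry (resolvent (Zle k0) (CMV_minus alpha t k0) z) k k' =
    G_minus_uv alpha t k0 k k' z.
Proof.
move=> h h'; rewrite entryE (resolvent_minus h' uvhat_minus_l2) /G_minus_uv;
  congr (_ * _).
by rewrite /green /cut !mem_Zle h h'.
Qed.

Lemma entry_full k k' :
  entry (resolvent setT (CMV alpha) z) k k' = G_full_uv alpha t k0 k k' z.
Proof. by rewrite entryE resolvent_full. Qed.

End Fixz.
End Green.

(** * Reflection in the unit circle *)

Section Star.
Variable R : realType.
Local Notation C := R[i].
Variables (alpha : int -> C) (t : R) (k0 : int).
Hypothesis ha : forall k, `|alpha k| < 1.
Variable z : C.
Hypothesis z0 : z != 0.
Hypothesis z1 : `|z| != 1.
Local Notation z' := (1 / z^*).
Local Notation p z := (pr_plus alpha t k0 z).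
Local Notation q z := (qs_plus alpha t k0 z).
Local Notation pm z := (pr_minus alpha t k0 z).
Local Notation qm z := (qs_minus alpha t k0 z).

Lemma z'0 : z' != 0.
Proof. by rewrite div1r invr_eq0 conjC_eq0. Qed.

Lemma z'1 : `|z'| != 1.
Proof. by rewrite div1r normfV norm_conjC invr_eq1. Qed.

Lemma z'_conj : (z')^* = z^-1.
Proof. by rewrite div1r fmorphV /= conjCK. Qed.

Lemma z'V_conj : (z'^-1)^* = z.
Proof. by rewrite div1r invrK conjCK. Qed.

(** Complex conjugation turns the transfer matrix at [1 / conj z] into the one
    at [z] with both rows and both columns exchanged. *)
Definition star (w : int -> 'cV[C]_2) k : 'cV[C]_2 := cv2 (w k 1 0)^* (w k 0 0)^*.

Lemma star_solution w : transfer_solution alpha z' w ->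
  transfer_solution alpha z (star w).
Proof.
move=> sw k; have /transfer_stepE[] := sw k.
move: z'_conj z'V_conj; move: (1 / z^*) => y hy hyV e0 e1.
have hr : ((rho (alpha k))^-1)^* = (rho (alpha k))^-1.
  by rewrite fmorphV /= conj_rho// ltW.
apply/transfer_stepE; rewrite /star !cvE e0 e1 !rmorphM /= hr.
by case: ifP => _; rewrite !rmorphD !rmorphM /= ?conjCK ?hyV ?hy; split; ring.
Qed.

Lemma star_l2vec D w : l2vec D w -> l2vec D (star w).
Proof.
move=> [h1 h2]; split.
  apply: (@eq_l2on _ _ (fun k => (w k 1 0)^*)); last exact: l2on_conj.
  by move=> k _; rewrite /star cvE.
apply: (@eq_l2on _ _ (fun k => (w k 0 0)^*)); last exact: l2on_conj.
by move=> k _; rewrite /star cvE.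
Qed.

Lemma star_scale w w0 c : transfer_solution alpha z' w ->
  transfer_solution alpha z w0 ->
  star w k0 = c *: w0 k0 -> star w = fun k => c *: w0 k.
Proof.
move=> sw sw0 e; apply: (transfer_uniq ha z0 (k0 := k0)) => //;
  first exact: star_solution.
by move=> k; rewrite /transfer_step (sw0 k) -scalemxAr.
Qed.

Lemma star_p : star (p z') = fun k => z ^- oddz k0 *: p z k.
Proof.
apply: star_scale; [exact: (p_solution _ _ ha z'0)|exact: (p_solution _ _ ha z0)|].
rewrite /star (p_init _ _ ha z'0) (p_init _ _ ha z0).
case: (oddz k0); rewrite !cvE; apply: cv2P; rewrite !scaleE !cvE.
- by rewrite expr1 mulKf.
- by rewrite rmorphM /= z'_conj conjCK expr1.
- by rewrite expr0 invr1 mul1r conjCK.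
- by rewrite expr0 invr1 mul1r.
Qed.

Lemma star_q : star (q z') = fun k => - z ^- oddz k0 *: q z k.
Proof.
apply: star_scale; [exact: (q_solution _ _ ha z'0)|exact: (q_solution _ _ ha z0)|].
rewrite /star (q_init _ _ ha z'0) (q_init _ _ ha z0).
case: (oddz k0); rewrite !cvE; apply: cv2P; rewrite !scaleE !cvE.
- by rewrite rmorphN expr1 mulNr mulKf.
- by rewrite rmorphM /= z'_conj conjCK expr1 mulrNN.
- by rewrite expr0 invr1 mulrNN mul1r conjCK.
- by rewrite expr0 invr1 rmorphN mulN1r.
Qed.

Lemma star_pm : star (pm z') = fun k => - z ^- oddz (k0 + 1) *: pm z k.
Proof.
apply: star_scale; [exact: (pm_solution _ _ ha z'0)|exact: (pm_solution _ _ ha z0)|].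
rewrite /star (pm_init _ _ ha z'0) (pm_init _ _ ha z0) oddzD.
case: (oddz k0); rewrite !cvE; apply: cv2P; rewrite !scaleE !cvE /=.
- by rewrite expr0 invr1 rmorphN mulN1r.
- by rewrite expr0 invr1 mulrNN mul1r conjCK.
- by rewrite expr1 conjCK mulrNN mulKf.
- by rewrite rmorphN rmorphM /= z'_conj expr1 mulNr.
Qed.

Lemma star_qm : star (qm z') = fun k => z ^- oddz (k0 + 1) *: qm z k.
Proof.
apply: star_scale; [exact: (qm_solution _ _ ha z'0)|exact: (qm_solution _ _ ha z0)|].
rewrite /star (qm_init _ _ ha z'0) (qm_init _ _ ha z0) oddzD.
case: (oddz k0); rewrite !cvE; apply: cv2P; rewrite !scaleE !cvE /=.
- by rewrite expr0 invr1 mul1r.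
- by rewrite expr0 invr1 mul1r conjCK.
- by rewrite expr1 conjCK mulKf.
- by rewrite rmorphM /= z'_conj expr1.
Qed.

Lemma star_comb w w' c : star (fun k => w k + c *: w' k) =
  fun k => star w k + c^* *: star w' k.
Proof.
apply/funext => k; apply: cv2P; rewrite /star !mxE.
  by rewrite /= rmorphD rmorphM.
by rewrite /= rmorphD rmorphM.
Qed.

Lemma scale_l2vec D (w : int -> 'cV[C]_2) c : c != 0 ->
  l2vec D (fun k => c *: w k) -> l2vec D w.
Proof.
move=> c0 h; have := l2vec_lin c^-1 0 h h.
by under eq_fun do rewrite scale0r addr0 scalerA mulVf// scale1r.
Qed.

Let zn (b : bool) : - z ^- b != 0.
Proof. by rewrite oppr_eq0 invr_eq0 expf_neq0. Qed.

Lemma star_weyl M : star (weyl_comb alpha t k0 z' M) =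
  fun k => - z ^- oddz k0 *: weyl_comb alpha t k0 z (- M^*) k.
Proof.
rewrite /weyl_comb star_comb star_p star_q; apply/funext => k.
by rewrite scalerDr !scalerA mulrNN [_ * M^*]mulrC.
Qed.

(** Reflection preserves square-summability, so the uniqueness of the Weyl
    coefficient gives [conj (M (1 / conj z)) = - M z]. *)
Lemma star_uv_plus : star (uv_plus alpha t k0 z') =
  fun k => - z ^- oddz k0 *: uv_plus alpha t k0 z k.
Proof.
rewrite /uv_plus star_weyl.
suff -> : - (M_plus alpha t k0 z')^* = M_plus alpha t k0 z by [].
apply: (M_plus_uniq ha z0 z1); apply: (scale_l2vec (zn (oddz k0))).
rewrite -star_weyl; apply: star_l2vec.
exact: (M_plusP _ _ ha z'0 z'1).
Qed.

Lemma star_uv_minus : star (uv_minus alpha t k0 z') =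
  fun k => - z ^- oddz k0 *: uv_minus alpha t k0 z k.
Proof.
rewrite /uv_minus star_weyl.
suff -> : - (M_minus alpha t k0 z')^* = M_minus alpha t k0 z by [].
apply: (M_minus_uniq ha z0 z1); apply: (scale_l2vec (zn (oddz k0))).
rewrite -star_weyl; apply: star_l2vec.
exact: (M_minusP _ _ ha z'0 z'1).
Qed.

Lemma star_uvhat_minus : star (uvhat_minus alpha t k0 z') =
  fun k => z ^- oddz (k0 + 1) *: uvhat_minus alpha t k0 z k.
Proof.
have E : star (uvhat_minus alpha t k0 z') =
  fun k => z ^- oddz (k0 + 1) *: (qm z k + - (m_minus alpha t k0 z')^* *: pm z k).
  rewrite /uvhat_minus star_comb star_pm star_qm; apply/funext => k.
  by rewrite scalerDr !scalerA !mulrN [_ * _^*]mulrC.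
rewrite E /uvhat_minus; apply/funext => k.
rewrite (@m_minus_uniq _ _ _ _ ha z z0 z1 (- (m_minus alpha t k0 z')^*))//.
apply: (@scale_l2vec _ _ (z ^- oddz (k0 + 1))); first by rewrite -oppr_eq0.
by rewrite -E; apply: star_l2vec; exact: (uvhat_minus_l2 _ _ ha z'0 z'1).
Qed.

Lemma star_bot w w0 c k : star w = (fun k => c *: w0 k) -> (w k 0 0)^* = c * w0 k 1 0.
Proof.
by move=> /(congr1 (fun F : int -> 'cV[C]_2 => F k 1 0)); rewrite /star cvE mxE.
Qed.

Lemma G_plus_uvE k k' : G_plus_uv alpha t k0 k k' z = G_plus_uu alpha t k0 k k' z.
Proof.
rewrite /G_plus_uv /G_plus_uu /uhat_plus /vhat_plus
  !(uvhat_plusE _ _ ha z0 z1) (uvhat_plusE _ _ ha z'0 z'1).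
rewrite /p_plus /r_plus (star_bot k' star_uv_plus) (star_bot k' star_p).
by case: ifP => _; ring.
Qed.

Lemma G_minus_uvE k k' : G_minus_uv alpha t k0 k k' z = G_minus_uu alpha t k0 k k' z.
Proof.
rewrite /G_minus_uv /G_minus_uu /uhat_minus /vhat_minus.
rewrite /p_minus /r_minus (star_bot k' star_uvhat_minus) (star_bot k' star_pm).
by case: ifP => _; ring.
Qed.

Lemma G_full_uvE k k' : G_full_uv alpha t k0 k k' z = G_full_uu alpha t k0 k k' z.
Proof.
rewrite /G_full_uv /G_full_uu /u_plus /u_minus /v_plus /v_minus.
rewrite (star_bot k' star_uv_plus) (star_bot k' star_uv_minus).
by case: ifP => _; ring.
Qed.

End Star.

(** * The theorem *)

Section Extend.
Variable R : realType.
Local Notation C := R[i].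

(** The extension is the resolvent entry itself, which is analytic on the
    whole disk. *)
Lemma extends_resolvent D (b : int -> C) k k' F :
  (forall k, `|b k| <= 1) -> reducing D b -> D k' ->
  (forall z, z != 0 -> `|z| != 1 -> entry (resolvent D (CMV b) z) k k' = F z) ->
  extends_to_0 F (entry (resolvent D (CMV b) 0) k k').
Proof.
move=> b1 rD Dk' h; exists (fun z => entry (resolvent D (CMV b) z) k k'); split => //.
  exact: CMV_resolvent_analytic.
move=> z /andP[z0 z1]; apply: h; first by rewrite -normr_gt0.
by rewrite lt_eqF.
Qed.

End Extend.

Theorem lemma2p6 (R : realType) (alpha : int -> R[i]) (t : R) (k0 : int)
    (halpha : forall k : int, `|alpha k| < 1) (ht : 0 <= t < 2 * pi) :
  let U := CMV alpha in
  let Up := CMV_plus alpha t k0 in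
  let Um := CMV_minus alpha t k0 in
  (forall z : R[i], z != 0 -> `|z| != 1 ->
    [/\ (* half-lattice [k0, +oo) *)
        [/\ in_resolvent_set (Zge k0) Up z,
            l2vec (Zge k0) (uvhat_plus alpha t k0 z)
          & forall k k' : int, k0 <= k -> k0 <= k' ->
              entry (resolvent (Zge k0) Up z) k k' =
                G_plus_uv alpha t k0 k k' z /\
              G_plus_uv alpha t k0 k k' z = G_plus_uu alpha t k0 k k' z],
        (* half-lattice (-oo, k0] *)
        [/\ in_resolvent_set (Zle k0) Um z,
            l2vec (Zle k0) (uvhat_minus alpha t k0 z)
          & forall k k' : int, k <= k0 -> k' <= k0 ->
              entry (resolvent (Zle k0) Um z) k k' =
                G_minus_uv alpha t k0 k k' z /\
              G_minus_uv alpha t k0 k k' z = G_minus_uu alpha t k0 k k' z]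
      & (* full lattice *)
        [/\ in_resolvent_set setT U z,
            exists! M : R[i], l2vec (Zge k0) (weyl_comb alpha t k0 z M),
            exists! M : R[i], l2vec (Zle k0) (weyl_comb alpha t k0 z M),
            M_plus alpha t k0 z != M_minus alpha t k0 z
          & forall k k' : int,
              entry (resolvent setT U z) k k' =
                G_full_uv alpha t k0 k k' z /\
              G_full_uv alpha t k0 k k' z = G_full_uu alpha t k0 k k' z]])
  /\
  (* unitarity and analytic extension to z = 0 *)
  [/\ [/\ unitary_on (Zge k0) Up, in_resolvent_set (Zge k0) Up 0
        & forall k k' : int, k0 <= k -> k0 <= k' ->
            extends_to_0 (G_plus_uv alpha t k0 k k')
              (entry (resolvent (Zge k0) Up 0) k k') /\
            extends_to_0 (G_plus_uu alpha t k0 k k')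
              (entry (resolvent (Zge k0) Up 0) k k')],
      [/\ unitary_on (Zle k0) Um, in_resolvent_set (Zle k0) Um 0
        & forall k k' : int, k <= k0 -> k' <= k0 ->
            extends_to_0 (G_minus_uv alpha t k0 k k')
              (entry (resolvent (Zle k0) Um 0) k k') /\
            extends_to_0 (G_minus_uu alpha t k0 k k')
              (entry (resolvent (Zle k0) Um 0) k k')]
    & [/\ unitary_on setT U, in_resolvent_set setT U 0
        & forall k k' : int,
            extends_to_0 (G_full_uv alpha t k0 k k')
              (entry (resolvent setT U 0) k k') /\
            extends_to_0 (G_full_uu alpha t k0 k k')
              (entry (resolvent setT U 0) k k')]].
Proof.
move=> U Up Um.
have p1 := set_alpha_le1 t halpha k0.
have m1 := set_alpha_le1 t halpha (k0 + 1).
have f1 k : `|alpha k| <= 1 by exact: ltW.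
have rp := reducing_Zge (norm_set_alpha alpha t k0).
have rm := reducing_Zle (norm_set_alpha alpha t (k0 + 1)).
have rf : reducing setT alpha by move=> k; right.
have O1 : `|0 : R[i]| != 1 by rewrite normr0 eq_sym oner_eq0.
split.
  move=> z z0 z1; split; split.
  - exact: CMV_in_resolvent.
  - exact: uvhat_plus_l2.
  - by move=> k k' h h'; split; [exact: entry_plus|exact: G_plus_uvE].
  - exact: CMV_in_resolvent.
  - exact: uvhat_minus_l2.
  - by move=> k k' h h'; split; [exact: entry_minus|exact: G_minus_uvE].
  - exact: CMV_in_resolvent.
  - exact: ex_M_plus.
  - exact: ex_M_minus.
  - exact: M_neq.
  - by move=> k k'; split; [exact: entry_full|exact: G_full_uvE].
split; split.
- exact: unitary_CMV.
- exact: CMV_in_resolvent.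
- move=> k k' h h'; split; apply: extends_resolvent => // z z0 z1.
    exact: entry_plus.
  by rewrite -G_plus_uvE//; exact: entry_plus.
- exact: unitary_CMV.
- exact: CMV_in_resolvent.
- move=> k k' h h'; split; apply: extends_resolvent => // z z0 z1.
    exact: entry_minus.
  by rewrite -G_minus_uvE//; exact: entry_minus.
- exact: unitary_CMV.
- exact: CMV_in_resolvent.
- move=> k k'; split; apply: extends_resolvent => // z z0 z1.
    exact: entry_full.
  by rewrite -G_full_uvE//; exact: entry_full.
Qed.
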